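(* Let $\Omega_{punc}$ be the discrete hull of a punctured tiling whose continuous hull $\Omega_T$ satisfies the standing assumptions given in the context, let $R_{punc}=\{(T',T'-x(t)) : T'\in\Omega_{punc},\ t\in T'\}$ be translational equivalence on $\Omega_{punc}$, and let $\mathcal{T}_R$ be the topology on $R_{punc}$ induced by the metric $$d_R\big((T_1,T_1-x(t_1)),(T_2,T_2-x(t_2))\big)=d_\Gamma(T_1,T_2)+|x(t_1)-x(t_2)| .$$ Then the triple $(\Omega_{punc},R_{punc},\mathcal{T}_R)$ is an étale equivalence relation.
   Context: **Tilings.** A tiling of $\mathbb{R}^2$ is a countable collection of closed polygonal subsets (tiles) covering $\mathbb{R}^2$ such that distinct tiles have disjoint interiors. A patch in a tiling is a finite subset of its tiles; $T\cap B(x,r)$ denotes the patch of tiles of $T$ completely contained in the open ball $B(x,r)$. $\Gamma=\mathbb{R}^2\rtimes \mathcal{S}^1$ is the group of orientation preserving isometries of $\mathbb{R}^2$, where $\mathcal{S}^1=SO(2,\mathbb{R})$ consists of the rotations $R_\theta$ about the origin; $(x,R_\theta)\in\Gamma$ acts on a tiling $T$ by $R_\theta(T+x)$. Put $d((x,R_\theta),(y,R_\phi))=|x-y|+\|R_\theta-R_\phi\|_{F}$ (Frobenius norm of the matrix difference). **Tiling metric.** For $0<\varepsilon<1$, say $T,T'$ are within $\varepsilon$ if there are $(x,R_\theta),(x',R_{\theta'})\in\Gamma$, each at $d$-distance $<\varepsilon$ from the identity, with $R_\theta(T+x)\cap B(0,\varepsilon^{-1})=R_{\theta'}(T'+x')\cap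 B(0,\varepsilon^{-1})$. Then $d_\Gamma(T,T')$ is the infimum of all such $\varepsilon$, or $1$ if there are none. The continuous hull $\Omega_T$ of a tiling $T$ is the completion of $\{T+x:x\in\mathbb{R}^2\}$ in $d_\Gamma$; its elements are tilings. **Proto-tiles.** $\{p_1,\dots,p_n\}$ is a finite nonempty set of closed polygons (proto-tiles) such that each tile of each tiling in $\Omega_T$ is $\gamma(p_i)$ for some $\gamma\in\Gamma$ and some $i$. **Standing assumptions.** (a) $\Gamma$ is the full group of orientation preserving isometries of $\mathbb{R}^2$; that is, for every $\gamma\in\Gamma$ and every proto-tile $p$ there is a tiling in $\Omega_T$ containing the tile $\gamma(p)$. (b) $\Omega_T$ has finite local complexity with respect to $\Gamma$: for every $r>0$ the set $\{T'\cap B(x,r):T'\in\Omega_T,\ x\in\mathbb{R}^2\}$ is finite modulo $\Gamma$. (c) $\Omega_T$ is strongly aperiodic: $T'+x\ne T'$ for all $T'\in\Omega_T$ and $x\neq 0$. **Punctures.** Each proto-tile $p_i$ has a chosen point $x(p_i)$ in its interior (its puncture) such that the pointed polygon $(p_i,x(p_i))$ has trivial symmetry group. Every tile $t=\gamma(p_i)$ gets the puncture $x(t)=\gamma(x(p_i))$. The discrete hull is $\Omega_{punc}=\{T'\in\Omega_T : \text{some tile } t\in T' \text{ has } x(t)=0\}$, with the metric $d_\Gamma$. **Étale equivalence relations.** For an equivalence relation $R\subset X\times X$, put $(x,y)(y,z)=(x,z)$ (products are defined only in this case), $(x,y)^{-1}=(y,x)$, $r(x,y)=x$, $s(x,y)=y$,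 $\Delta=\{(x,x):x\in X\}$; for $U,V\subset R$, $UV$ is the set of all defined products and $U^{-1}$ the set of inverses. The triple $(X,R,\mathcal{T})$ is an étale equivalence relation if $X$ is compact Hausdorff and: (i) $(R,\mathcal T)$ is $\sigma$-compact; (ii) $\Delta$ is open in $(R,\mathcal T)$; (iii) every $(x,y)\in R$ has an open neighbourhood $U$ such that $r:U\to r(U)$ and $s:U\to s(U)$ are homeomorphisms; (iv) $UV$ is open whenever $U,V\subset R$ are open; (v) $U^{-1}$ is open whenever $U\subset R$ is open. *)

(* Defs.v *)
From HB Require Import structures.
From mathcomp Require Import all_boot all_order all_algebra.
From mathcomp Require Import all_classical all_reals all_analysis.

Set Implicit Arguments.
Unset Strict Implicit.
Unset Printing Implicit Defensive.

Import Order.TTheory GRing.Theory Num.Theory.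
Import numFieldNormedType.Exports.

Local Open Scope classical_set_scope.
Local Open Scope ring_scope.

(* [metric_space d] is [Y] with the topology in which [U] is open iff every
   point of [U] has a [d]-ball contained in [U].  These sets form a topology
   for an arbitrary function [d], so no metric axiom is needed to write it. *)
Definition metric_space (R : realType) (Y : Type) (d : Y -> Y -> R) : Type := Y.

Section MetricSpace.
Variables (R : realType) (Y : Type) (d : Y -> Y -> R).

Definition metric_open (U : set Y) : Prop :=
  forall a, U a -> exists2 e : R, 0 < e & forall b, d a b < e -> U b.

Lemma metric_openT : metric_open setT.
Proof. by move=> a _; exists 1. Qed.

Lemma metric_openI : setI_closed metric_open.
Proof.
move=> U V oU oV a [/oU[e e0 Ue] /oV[f f0 Vf]].
exists (Num.min e f); first by rewrite lt_min e0 f0.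
by move=> b; rewrite lt_min => /andP[/Ue ? /Vf ?].
Qed.

Lemma metric_open_bigU (I : Type) (f : I -> set Y) :
  (forall i, metric_open (f i)) -> metric_open (\bigcup_i f i).
Proof.
move=> of_ a [i _ /of_ [e e0 fe]]; exists e => // b /fe fb; by exists i.
Qed.

HB.instance Definition _ := gen_eqMixin (metric_space d).
HB.instance Definition _ := gen_choiceMixin (metric_space d).
HB.instance Definition _ := isOpenTopological.Build (metric_space d)
  metric_openT metric_openI metric_open_bigU.

Definition metric_cauchy (u : nat -> Y) : Prop :=
  forall e : R, 0 < e -> exists N : nat, forall m k : nat,
    (N <= m)%N -> (N <= k)%N -> d (u m) (u k) < e.

Definition metric_limit (u : nat -> Y) (a : Y) : Prop :=
  forall e : R, 0 < e -> exists N : nat, forall m : nat,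
    (N <= m)%N -> d (u m) a < e.

Definition is_completion (A W : set Y) : Prop :=
  [/\ A `<=` W,
      forall a, W a -> forall e : R, 0 < e -> exists2 b, A b & d a b < e &
      forall u, (forall k, W (u k)) -> metric_cauchy u ->
        exists2 a, W a & metric_limit u a].

End MetricSpace.

Section Etale.

Definition homeo_onto_image (Y Z : topologicalType) (f : Y -> Z) (U : set Y) :
    Prop :=
  {within U, continuous f} /\
  exists2 h : Z -> Y, {within f @` U, continuous h}
                    & forall y, U y -> h (f y) = y.

Definition sigma_compact (Y : topologicalType) : Prop :=
  exists2 K : nat -> set Y, forall k, compact (K k) & \bigcup_k K k = setT.

Definition is_equivalence (X : Type) (E : set (X * X)) : Prop :=
  [/\ forall a, E (a, a),
      forall a b, E (a, b) -> E (b, a) &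
      forall a b c, E (a, b) -> E (b, c) -> E (a, c)].

(* The space [G], together with the bijection [pr] from [G] onto [E], is the
   relation [E] equipped with its topology. *)
Variables (X : topologicalType) (E : set (X * X)).
Variables (G : topologicalType) (pr : G -> X * X).

Definition rel_r (g : G) : X := (pr g).1.
Definition rel_s (g : G) : X := (pr g).2.

Definition rel_diag : set G := [set g | rel_r g = rel_s g].

Definition rel_mul (U V : set G) : set G :=
  [set g | exists u v, [/\ U u, V v, rel_s u = rel_r v &
                           pr g = (rel_r u, rel_s v)]].

Definition rel_inv (U : set G) : set G :=
  [set g | exists2 u, U u & pr g = (rel_s u, rel_r u)].

Definition etale_equivalence_relation : Prop :=
  [/\ is_equivalence E /\ set_bij [set: G] E pr,
      compact [set: X] /\ hausdorff_space X,
      sigma_compact G /\ open rel_diag,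
      forall g : G, exists U : set G,
        [/\ open U, U g, homeo_onto_image rel_r U & homeo_onto_image rel_s U] &
      (forall U V : set G, open U -> open V -> open (rel_mul U V)) /\
      (forall U : set G, open U -> open (rel_inv U))].

End Etale.

Section Tilings.
Variable R : realType.

(* The library norm on matrices is the sup norm; this is the Euclidean norm of
   a vector, and the Frobenius norm of a square matrix. *)
Definition frob (m n : nat) (A : 'M[R]_(m, n)) : R :=
  Num.sqrt (\sum_i \sum_j A i j ^+ 2).

Definition eball (x : 'cV[R]_2) (r : R) : set 'cV[R]_2 :=
  [set y | frob (y - x) < r].

Definition triangle (a b c : 'cV[R]_2) : set 'cV[R]_2 :=
  [set y | exists s t u : R, [/\ 0 <= s, 0 <= t, 0 <= u, s + t + u = 1 &
                                 y = s *: a + t *: b + u *: c]].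

Definition nondegenerate (a b c : 'cV[R]_2) : Prop :=
  \det (row_mx (b - a) (c - a) : 'M[R]_2) != 0.

(* Polygonal regions: finite nonempty unions of nondegenerate triangles. *)
Definition closed_polygon (P : set 'cV[R]_2) : Prop :=
  exists (m : nat) (a b c : 'I_m.+1 -> 'cV[R]_2),
    (forall k, nondegenerate (a k) (b k) (c k)) /\
    P = \bigcup_k triangle (a k) (b k) (c k).

Definition tiles : Type := set (set 'cV[R]_2).

Definition is_tiling (T : tiles) : Prop :=
  [/\ countable T,
      forall t, T t -> closed_polygon t,
      \bigcup_(t in T) t = setT &
      forall t t', T t -> T t' -> t <> t' -> interior t `&` interior t' = set0].

(* [(x, A)] stands for the isometry [y |-> A (y + x)]; it belongs to the group
   when [A] is in SO(2). *)
Definition Gamma : set ('cV[R]_2 * 'M[R]_2) :=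
  [set g | g.2^T *m g.2 = 1%:M /\ \det g.2 = 1].

Definition Gamma1 : 'cV[R]_2 * 'M[R]_2 := (0, 1%:M).

Definition Gamma_dist (g h : 'cV[R]_2 * 'M[R]_2) : R :=
  frob (g.1 - h.1) + frob (g.2 - h.2).

Definition pact (g : 'cV[R]_2 * 'M[R]_2) (y : 'cV[R]_2) : 'cV[R]_2 :=
  g.2 *m (y + g.1).

Definition tact (g : 'cV[R]_2 * 'M[R]_2) (t : set 'cV[R]_2) : set 'cV[R]_2 :=
  pact g @` t.

Definition act (g : 'cV[R]_2 * 'M[R]_2) (T : tiles) : tiles := tact g @` T.

Definition translate (x : 'cV[R]_2) (T : tiles) : tiles :=
  (fun t => (fun y => y + x) @` t) @` T.

Definition patch (T : tiles) (x : 'cV[R]_2) (r : R) : tiles :=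
  [set t | T t /\ t `<=` eball x r].

Definition tiling_within (e : R) (T T' : tiles) : Prop :=
  exists g g', [/\ Gamma g, Gamma g', Gamma_dist g Gamma1 < e,
                   Gamma_dist g' Gamma1 < e &
                   patch (act g T) 0 e^-1 = patch (act g' T') 0 e^-1].

Definition tiling_dist (T T' : tiles) : R :=
  let S := [set e : R | 0 < e < 1 /\ tiling_within e T T'] in
  if `[< S !=set0 >] then inf S else 1.

Definition is_continuous_hull (T : tiles) (Omega : set tiles) : Prop :=
  (forall T', Omega T' -> is_tiling T') /\
  is_completion tiling_dist (range (translate^~ T)) Omega.

Definition prototiles_of (n : nat) (p : 'I_n -> set 'cV[R]_2)
    (Omega : set tiles) : Prop :=
  [/\ (0 < n)%N,
      forall i, closed_polygon (p i) &
      forall T' t, Omega T' -> T' t -> exists g i, Gamma g /\ t = tact g (p i)].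

Definition full_isometry_group (n : nat) (p : 'I_n -> set 'cV[R]_2)
    (Omega : set tiles) : Prop :=
  forall g i, Gamma g -> exists2 T', Omega T' & T' (tact g (p i)).

Definition finite_local_complexity (Omega : set tiles) : Prop :=
  forall r : R, 0 < r -> exists2 F : set tiles, finite_set F &
    forall T' x, Omega T' ->
      exists g P, [/\ Gamma g, F P & patch T' x r = act g P].

Definition strongly_aperiodic (Omega : set tiles) : Prop :=
  forall T' x, Omega T' -> x != 0 -> translate x T' <> T'.

Section Punctures.
Variables (n : nat) (p : 'I_n -> set 'cV[R]_2) (x : 'I_n -> 'cV[R]_2).

Definition puncturing : Prop :=
  forall i, interior (p i) (x i) /\
    forall g, Gamma g -> tact g (p i) = p i -> pact g (x i) = x i -> g = Gamma1.

(* [is_puncture t v] says that [v] is the puncture of [t]; it is a relation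
   because [t] need not determine [g] and [i]. *)
Definition is_puncture (t : set 'cV[R]_2) (v : 'cV[R]_2) : Prop :=
  exists g i, [/\ Gamma g, t = tact g (p i) & v = pact g (x i)].

Definition discrete_hull (Omega : set tiles) : set tiles :=
  [set T' | Omega T' /\ exists2 t, T' t & is_puncture t 0].

Definition is_displacement (TS : tiles * tiles) (v : 'cV[R]_2) : Prop :=
  (exists2 t, TS.1 t & is_puncture t v) /\ TS.2 = translate (- v) TS.1.

Definition R_punc (Omega : set tiles) : set (tiles * tiles) :=
  [set TS | discrete_hull Omega TS.1 /\ exists v, is_displacement TS v].

(* Strong aperiodicity makes the displacement of a pair unique. *)
Definition displacement (TS : tiles * tiles) : 'cV[R]_2 :=
  xget 0 (is_displacement TS).

Definition R_dist (a b : tiles * tiles) : R :=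
  tiling_dist a.1 b.1 + frob (displacement a - displacement b).

Variable Omega : set tiles.

Definition discrete_hull_space : topologicalType :=
  metric_space (fun a b : {T' | discrete_hull Omega T'} =>
                  tiling_dist (sval a) (sval b)).

Definition hull_val (a : discrete_hull_space) : tiles := sval a.

Definition hull_rel : set (discrete_hull_space * discrete_hull_space) :=
  [set ab | R_punc Omega (hull_val ab.1, hull_val ab.2)].

Definition hull_rel_val (c : {ab | hull_rel ab}) : tiles * tiles :=
  (hull_val (sval c).1, hull_val (sval c).2).

Definition R_punc_space : topologicalType :=
  metric_space (fun a b => R_dist (hull_rel_val a) (hull_rel_val b)).

Definition R_punc_pr (c : R_punc_space) :
  discrete_hull_space * discrete_hull_space := sval c.

End Punctures.

End Tilings.

(* Main.v *)
(** Two tilings are close when one small isometry makes them agree on a large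
    ball about the origin; this description of the topology behaves well under
    composition and translation.  The punctures of a tiling of the
    hull are uniformly separated: punctures of different tiles by the radius of
    a disc inscribed in the proto-tiles, and punctures of one tile because a
    polygon has finitely many symmetries.  A puncture of a tiling can therefore
    be followed, in a unique and continuous way, to every nearby tiling.  This
    makes the range map injective with continuous inverse on the pairs whose
    displacement is close to a given one, and it carries a factorisation of a
    pair to the nearby pairs; aperiodicity identifies a pair with its first
    tiling and its displacement.  Compactness is completeness together with
    total boundedness; the latter is finite local complexity, because tilings
    with a puncture at the origin have their central patches related by a
    bounded set of isometries. *)

Require Import Defs.
From mathcomp Require Import all_boot all_order all_algebra.
From mathcomp Require Import all_classical all_reals all_analysis.
From mathcomp Require Import ring lra.

Set Implicit Arguments.
Unset Strict Implicit.
Unset Printing Implicit Defensive.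

Import Order.TTheory GRing.Theory Num.Theory.
Import numFieldNormedType.Exports.

Local Open Scope classical_set_scope.
Local Open Scope ring_scope.

(* The library has its own [patch] and [nondegenerate]. *)
Local Notation patch := Defs.patch.
Local Notation nondegenerate := Defs.nondegenerate.

(** * The Frobenius norm *)

Section Frobenius.
Variable R : realType.

(** Expanding the sum of the squares (B f_i - C g_i)^2 gives B (A B - C^2) >= 0; if B = 0 then every
    g_i vanishes and both sides are 0. *)
Lemma Cauchy_Schwarz_sum (I : finType) (f g : I -> R) :
  (\sum_i f i * g i) ^+ 2 <= (\sum_i f i ^+ 2) * (\sum_i g i ^+ 2).
Proof.
set A := \sum_i f i ^+ 2; set B := \sum_i g i ^+ 2; set C := \sum_i f i * g i.
have B0 : 0 <= B by apply: sumr_ge0 => i _; exact: sqr_ge0.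
have : 0 <= \sum_i (B * f i - C * g i) ^+ 2.
  by apply: sumr_ge0 => i _; exact: sqr_ge0.
have -> : \sum_i (B * f i - C * g i) ^+ 2 = B * (A * B - C ^+ 2).
  under eq_bigr => i _.
    rewrite (_ : (B * f i - C * g i) ^+ 2 =
      B ^+ 2 * f i ^+ 2 - (2 * B * C) * (f i * g i) + C ^+ 2 * g i ^+ 2);
      last by ring.
    over.
  rewrite big_split /= sumrB -!mulr_sumr -/A -/B -/C; ring.
have [B_gt0|] := ltP 0 B; first by rewrite pmulr_rge0 // subr_ge0.
move=> B_le0 _; have B_eq0 : B = 0 by apply/eqP; rewrite eq_le B_le0.
have g0 i : g i = 0.
  have /psumr_eq0P : forall i, true -> 0 <= g i ^+ 2 by move=> j _; exact: sqr_ge0.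
  by move=> /(_ B_eq0 i isT) /eqP; rewrite sqrf_eq0 => /eqP.
by rewrite /C big1 ?expr0n ?B_eq0 ?mulr0 //= => i _; rewrite g0 mulr0.
Qed.

Section Matrices.
Variables m n : nat.
Implicit Types A B : 'M[R]_(m, n).

Lemma frobE A : frob A = Num.sqrt (\sum_(k : 'I_m * 'I_n) A k.1 k.2 ^+ 2).
Proof. by rewrite /frob pair_bigA. Qed.

Lemma frob_ge0 A : 0 <= frob A.
Proof. exact: sqrtr_ge0. Qed.

Lemma frob_sqr A : frob A ^+ 2 = \sum_(k : 'I_m * 'I_n) A k.1 k.2 ^+ 2.
Proof. by rewrite frobE sqr_sqrtr // sumr_ge0 // => k _; exact: sqr_ge0. Qed.

Lemma frob_entry A i j : `|A i j| <= frob A.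
Proof.
rewrite frobE -sqrtr_sqr ler_wsqrtr // (bigD1 (i, j)) //= lerDl.
by apply: sumr_ge0 => k _; exact: sqr_ge0.
Qed.

Lemma frob0 : frob (0 : 'M[R]_(m, n)) = 0.
Proof. by rewrite frobE big1 ?sqrtr0 // => k _; rewrite mxE expr0n. Qed.

Lemma frob_eq0 A : frob A = 0 -> A = 0.
Proof.
move=> A0; apply/matrixP => i j; rewrite mxE; apply/eqP.
by rewrite -normr_le0 -A0 frob_entry.
Qed.

Lemma frobN A : frob (- A) = frob A.
Proof.
by rewrite !frobE; congr Num.sqrt; apply: eq_bigr => k _; rewrite mxE sqrrN.
Qed.

Lemma frobC A B : frob (A - B) = frob (B - A).
Proof. by rewrite -frobN opprB. Qed.

Lemma frobD A B : frob (A + B) <= frob A + frob B.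
Proof.
rewrite -(@ler_pXn2r _ 2) ?nnegrE ?addr_ge0 ?frob_ge0 //.
rewrite sqrrD !frob_sqr.
have -> : \sum_(k : 'I_m * 'I_n) (A + B) k.1 k.2 ^+ 2 =
    \sum_(k : 'I_m * 'I_n) A k.1 k.2 ^+ 2 +
    (\sum_(k : 'I_m * 'I_n) A k.1 k.2 * B k.1 k.2) *+ 2 +
    \sum_(k : 'I_m * 'I_n) B k.1 k.2 ^+ 2.
  rewrite -sumrMnl -!big_split /=; apply: eq_bigr => k _.
  by rewrite mxE sqrrD.
rewrite lerD2r lerD2l lerMn2r /=.
apply: le_trans (ler_norm _) _.
rewrite -(@ler_pXn2r _ 2) ?nnegrE ?mulr_ge0 ?frob_ge0 //.
rewrite real_normK ?num_real // exprMn !frob_sqr; exact: Cauchy_Schwarz_sum.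
Qed.

Lemma frob_tri C A B : frob (A - B) <= frob (A - C) + frob (C - B).
Proof. by rewrite -[A - B](subrKA C) frobD. Qed.

Lemma frob_trD A B : frob A <= frob B + frob (A - B).
Proof. by rewrite -{1}[A](addrNK B) addrC frobD. Qed.

Lemma frob_sum_entries A : frob A <= \sum_i \sum_j `|A i j|.
Proof.
rewrite pair_bigA /= -(@ler_pXn2r _ 2) ?nnegrE ?frob_ge0 ?sumr_ge0 //.
rewrite frob_sqr expr2 mulr_suml; apply: ler_sum => k _.
rewrite -real_normK ?num_real // expr2 ler_wpM2l // (bigD1 k) //= lerDl.
by rewrite sumr_ge0.
Qed.

Lemma frob_sqr_tr A : frob A ^+ 2 = \tr (A^T *m A).
Proof.
rewrite frob_sqr /mxtrace -(pair_bigA _ (fun i j => A i j ^+ 2)) exchange_big.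
apply: eq_bigr => j _; rewrite mxE; apply: eq_bigr => i _.
by rewrite mxE expr2.
Qed.

End Matrices.

Lemma frob_orthol (m n : nat) (A : 'M[R]_m) (B : 'M[R]_(m, n)) :
  A^T *m A = 1%:M -> frob (A *m B) = frob B.
Proof.
move=> oA; apply/eqP; rewrite -(@eqrXn2 _ 2) ?frob_ge0 //; apply/eqP.
by rewrite !frob_sqr_tr trmx_mul mulmxA -(mulmxA B^T) oA mulmx1.
Qed.

Lemma frob_orthor (m n : nat) (A : 'M[R]_n) (B : 'M[R]_(m, n)) :
  A *m A^T = 1%:M -> frob (B *m A) = frob B.
Proof.
move=> oA; apply/eqP; rewrite -(@eqrXn2 _ 2) ?frob_ge0 //; apply/eqP.
by rewrite !frob_sqr_tr trmx_mul mxtrace_mulC mulmxA -(mulmxA B) oA mulmx1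
  mxtrace_mulC.
Qed.

Lemma frob_mulmx (m n : nat) (A : 'M[R]_(m, n)) (y : 'cV[R]_n) :
  frob (A *m y) <= frob A * frob y.
Proof.
rewrite -(@ler_pXn2r _ 2) ?nnegrE ?mulr_ge0 ?frob_ge0 // exprMn.
rewrite [frob (A *m y) ^+ 2]frob_sqr -(pair_bigA _ (fun i j => (A *m y) i j ^+ 2)) /=.
have -> : frob y ^+ 2 = \sum_j y j 0 ^+ 2.
  rewrite frob_sqr -(pair_bigA _ (fun i j => y i j ^+ 2)) /=.
  by apply: eq_bigr => i _; rewrite big_ord1.
rewrite frob_sqr -(pair_bigA _ (fun i j => A i j ^+ 2)) /= mulr_suml.
apply: ler_sum => i _; rewrite big_ord1 mxE; exact: Cauchy_Schwarz_sum.
Qed.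

(** The ambient topology is that of the sup norm, which is bounded by [frob], while [frob] is at
    most the sum of the two absolute entries; hence the radius [r / 2] in the converse. *)
Lemma nbhs_eball (x : 'cV[R]_2) (U : set 'cV[R]_2) :
  nbhs x U <-> exists2 r : R, 0 < r & eball x r `<=` U.
Proof.
split=> [/nbhs_ballP[e /= e0 eU]|[r r0 rU]].
  exists e => // y xy; apply: eU; split=> // i j; rewrite /ball /= distrC.
  by apply: le_lt_trans xy; rewrite -[leRHS]frobN opprB
    (le_trans _ (frob_entry _ i j)) // !mxE distrC.
apply/nbhs_ballP; exists (r / 2) => /=; first by rewrite divr_gt0.
move=> y [_ xy]; apply: rU; apply: le_lt_trans (frob_sum_entries _) _.
rewrite big_ord_recl big_ord1 !big_ord1 !mxE.
have h i : `|y i 0 - x i 0| < r / 2 by rewrite distrC; exact: xy.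
by rewrite [ltRHS](splitr r) ltrD.
Qed.

Lemma interior_eball (x y : 'cV[R]_2) (r : R) (U : set 'cV[R]_2) :
  eball x r `<=` U -> eball x r y -> interior U y.
Proof.
move=> rU xy; apply/nbhs_eball; exists (r - frob (y - x)).
  by rewrite subr_gt0.
move=> z; rewrite /eball /= ltrBrDr => yz; apply: rU.
exact: le_lt_trans (frob_tri y _ _) yz.
Qed.

End Frobenius.

(** * The group of orientation preserving isometries *)

Section Isometries.
Variable R : realType.
Implicit Types (g h k : 'cV[R]_2 * 'M[R]_2) (y z v : 'cV[R]_2).
Implicit Types (t : set 'cV[R]_2) (T : tiles R).

(** Composition for the encoding y |-> A (y + x): the translation of [g] is pulled back through the
    rotation of [h], whose inverse is its transpose. *)
Definition gmul g h : 'cV[R]_2 * 'M[R]_2 :=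
  (h.1 + h.2^T *m g.1, g.2 *m h.2).
Definition ginv g : 'cV[R]_2 * 'M[R]_2 := (- (g.2 *m g.1), g.2^T).
Definition gtrans v : 'cV[R]_2 * 'M[R]_2 := (v, 1%:M).
Definition gnorm g : R := Gamma_dist g (Gamma1 R).

Lemma Gamma_trK g : Gamma g -> g.2 *m g.2^T = 1%:M.
Proof. by case=> h _; apply: mulmx1C. Qed.

Lemma Gamma_mul g h : Gamma g -> Gamma h -> Gamma (gmul g h).
Proof.
move=> [og dg] [oh dh]; split => /=; last by rewrite det_mulmx dg dh mulr1.
by rewrite trmx_mul mulmxA -(mulmxA _ g.2^T) og mulmx1 oh.
Qed.

Lemma Gamma_inv g : Gamma g -> Gamma (ginv g).
Proof.
move=> Gg; split => /=; first by rewrite trmxK Gamma_trK.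
by rewrite det_tr; case: Gg.
Qed.

Lemma Gamma_trans v : Gamma (gtrans v).
Proof. by split => /=; rewrite ?trmx1 ?mulmx1 ?det1. Qed.

Lemma Gamma_1 : Gamma (Gamma1 R).
Proof. exact: Gamma_trans. Qed.

Lemma pact_mul g h y : Gamma h -> pact (gmul g h) y = pact g (pact h y).
Proof.
move=> Gh; rewrite /pact /= -mulmxA; congr (_ *m _).
by rewrite addrA !(mulmxDr h.2) mulmxA Gamma_trK // mul1mx.
Qed.

Lemma pactK g y : Gamma g -> pact (ginv g) (pact g y) = y.
Proof.
by move=> [og _]; rewrite /pact /= -mulmxBr addrK mulmxA og mul1mx.
Qed.

Lemma pactKV g y : Gamma g -> pact g (pact (ginv g) y) = y.
Proof.
move=> Gg; rewrite /pact /= mulmxBr (mulmxA g.2^T g.2); case: (Gg) => -> _.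
by rewrite mul1mx addrNK mulmxA Gamma_trK // mul1mx.
Qed.

Lemma pact1 y : pact (Gamma1 R) y = y.
Proof. by rewrite /pact /= mul1mx addr0. Qed.

Lemma pact_trans v y : pact (gtrans v) y = y + v.
Proof. by rewrite /pact /= mul1mx. Qed.

Lemma pact_dist g y z : Gamma g -> frob (pact g y - pact g z) = frob (y - z).
Proof.
by move=> [og _]; rewrite /pact -mulmxBr frob_orthol // opprD addrACA subrr addr0.
Qed.

Lemma tact_mul g h t : Gamma h -> tact (gmul g h) t = tact g (tact h t).
Proof.
move=> Gh; rewrite /tact image_comp; congr (_ @` _).
by apply/funext => y; rewrite /= pact_mul.
Qed.

Lemma tactK g t : Gamma g -> tact (ginv g) (tact g t) = t.
Proof.
move=> Gg; rewrite /tact image_comp.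
by rewrite (eq_imagel (f' := id)) ?image_id // => y _ /=; rewrite pactK.
Qed.

Lemma tactKV g t : Gamma g -> tact g (tact (ginv g) t) = t.
Proof.
move=> Gg; rewrite /tact image_comp.
by rewrite (eq_imagel (f' := id)) ?image_id // => y _ /=; rewrite pactKV.
Qed.

Lemma tact1 t : tact (Gamma1 R) t = t.
Proof.
by rewrite /tact (eq_imagel (f' := id)) ?image_id // => y _ /=; rewrite pact1.
Qed.

Lemma tact_inj g t t' : Gamma g -> tact g t = tact g t' -> t = t'.
Proof. by move=> Gg e; rewrite -(tactK t Gg) e tactK. Qed.

Lemma act_mul g h T : Gamma h -> act (gmul g h) T = act g (act h T).
Proof.
move=> Gh; rewrite /act image_comp; congr (_ @` _).
by apply/funext => t; rewrite /= tact_mul.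
Qed.

Lemma actK g T : Gamma g -> act (ginv g) (act g T) = T.
Proof.
move=> Gg; rewrite /act image_comp.
by rewrite (eq_imagel (f' := id)) ?image_id // => y _ /=; rewrite tactK.
Qed.

Lemma act1 T : act (Gamma1 R) T = T.
Proof.
by rewrite /act (eq_imagel (f' := id)) ?image_id // => y _ /=; rewrite tact1.
Qed.

Lemma act_mem g T t : Gamma g -> act g T (tact g t) <-> T t.
Proof.
move=> Gg; split=> [[t' Tt' /tact_inj <-]//|Tt]; by exists t.
Qed.

Lemma translate_act v T : translate v T = act (gtrans v) T.
Proof.
rewrite /translate /act; congr (_ @` _); apply/funext => t.
by rewrite /tact; congr (_ @` _); apply/funext => y; rewrite pact_trans.
Qed.

Lemma translate0 T : translate 0 T = T.
Proof. by rewrite translate_act act1. Qed.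

Lemma translateD v v' T : translate v (translate v' T) = translate (v + v') T.
Proof.
rewrite !translate_act -act_mul; last exact: Gamma_trans.
by rewrite /gmul /gtrans /= trmx1 !mul1mx addrC.
Qed.

(** * The size of an isometry *)

Lemma gnormE g : gnorm g = frob g.1 + frob (g.2 - 1%:M).
Proof. by rewrite /gnorm /Gamma_dist subr0. Qed.

Lemma gnorm_ge0 g : 0 <= gnorm g.
Proof. by rewrite gnormE addr_ge0 ?frob_ge0. Qed.

Lemma gnorm1 : gnorm (Gamma1 R) = 0.
Proof. by rewrite gnormE subrr !frob0 addr0. Qed.

Lemma gnorm_eq0 g : gnorm g = 0 -> g = Gamma1 R.
Proof.
move=> /eqP; rewrite gnormE paddr_eq0 ?frob_ge0 // => /andP[/eqP a /eqP b].
case: g a b => a b /= /frob_eq0 -> /frob_eq0 /eqP.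
by rewrite subr_eq0 => /eqP ->.
Qed.

Lemma gnorm_trans v : gnorm (gtrans v) = frob v.
Proof. by rewrite gnormE subrr frob0 addr0. Qed.

Lemma gnorm_mul g h : Gamma g -> Gamma h ->
  gnorm (gmul g h) <= gnorm g + gnorm h.
Proof.
move=> Gg Gh; rewrite !gnormE /=.
have h1 : frob (h.1 + h.2^T *m g.1) <= frob h.1 + frob g.1.
  rewrite (le_trans (frobD _ _)) // frob_orthol //.
  by rewrite trmxK Gamma_trK.
have h2 : frob (g.2 *m h.2 - 1%:M) <= frob (g.2 - 1%:M) + frob (h.2 - 1%:M).
  rewrite (le_trans (frob_tri h.2 _ _)) // lerD2r -{2}[h.2]mul1mx -mulmxBl.
  by rewrite frob_orthor // Gamma_trK.
by move: h1 h2; lra.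
Qed.

Lemma gnorm_inv g : Gamma g -> gnorm (ginv g) = gnorm g.
Proof.
move=> Gg; rewrite !gnormE /= frobN frob_orthol; last by case: Gg.
congr (_ + _); have <- : g.2^T *m (1%:M - g.2) = g.2^T - 1%:M.
  by rewrite mulmxBr mulmx1; case: Gg => ->.
by rewrite frob_orthol 1?frobC // trmxK Gamma_trK.
Qed.

(** Rotating by [h.2] changes neither norm, so the distance on the group is right invariant: the
    size of a quotient is the distance between its two factors. *)
Lemma gnorm_divr g h : Gamma g -> Gamma h ->
  gnorm (gmul g (ginv h)) = frob (g.1 - h.1) + frob (g.2 - h.2).
Proof.
move=> Gg Gh; rewrite gnormE /= trmxK [X in frob X + _]addrC -mulmxBr.
rewrite frob_orthol; last by case: Gh.
congr (_ + _).
have -> : g.2 *m h.2^T - 1%:M = (g.2 - h.2) *m h.2^T.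
  by rewrite mulmxBl Gamma_trK.
by rewrite frob_orthor //; case: Gh => oh _; rewrite trmxK.
Qed.

Lemma gmul_div g h k : Gamma g -> Gamma h -> Gamma k ->
  gnorm (gmul (gmul g (ginv k)) (ginv (gmul h (ginv k)))) =
  gnorm (gmul g (ginv h)).
Proof.
move=> Gg Gh Gk; have Gk' := Gamma_inv Gk.
rewrite !gnorm_divr //; [|exact: Gamma_mul..] => /=.
rewrite trmxK opprD addrACA subrr add0r -mulmxBr frob_orthol; last by case: Gk.
congr (_ + _); rewrite -mulmxBl frob_orthor //; case: Gk => oh _; by rewrite trmxK.
Qed.

Lemma pact_norm g y : Gamma g -> frob (pact g y) <= frob y + gnorm g.
Proof.
move=> [og _]; rewrite /pact frob_orthol // gnormE (le_trans (frobD _ _)) //.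
by rewrite lerD2l lerDl frob_ge0.
Qed.

Lemma pact_move g y : Gamma g -> frob (pact g y - y) <= gnorm g * (1 + frob y).
Proof.
move=> [og _]; rewrite /pact gnormE mulmxDr addrAC -[X in _ - X + _]mul1mx -mulmxBl.
rewrite (le_trans (frobD _ _)) // frob_orthol //.
apply: le_trans (lerD (frob_mulmx _ _) (lexx _)) _.
have := frob_ge0 g.1; have := frob_ge0 y; have := frob_ge0 (g.2 - 1%:M).
move: (frob _) (frob _) (frob _) => a b c *; nra.
Qed.

(** Conjugating by a translation keeps the rotation A and adds to the translation part a rotated
    copy of the defect (1 - A) v. *)
Lemma gnorm_conj g v : Gamma g ->
  gnorm (gmul (gtrans v) (gmul g (gtrans (- v)))) <= gnorm g * (1 + frob v).
Proof.
move=> Gg; rewrite !gnormE /= trmx1 !mul1mx mulmx1.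
have -> : - v + g.1 + g.2^T *m v = g.1 + g.2^T *m ((1%:M - g.2) *m v).
  rewrite mulmxBl mul1mx mulmxBr mulmxA; case: Gg => -> _.
  by rewrite mul1mx -addrA addrCA [- v + _]addrC.
have h1 : frob (g.1 + g.2^T *m ((1%:M - g.2) *m v)) <=
    frob g.1 + frob (g.2 - 1%:M) * frob v.
  rewrite (le_trans (frobD _ _)) // lerD2l frob_orthol.
    by rewrite frobC frob_mulmx.
  by rewrite trmxK Gamma_trK.
apply: le_trans (lerD h1 (lexx _)) _.
have := frob_ge0 g.1; have := frob_ge0 v; have := frob_ge0 (g.2 - 1%:M).
move: (frob _) (frob _) (frob _) => a b c *; nra.
Qed.

Lemma ord2E (i : 'I_2) : i = ord0 \/ i = ord_max.
Proof. by case: i => -[|[|//]] ?; [left|right]; exact: val_inj. Qed.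

(* A special orthogonal 2x2 matrix is [[c, -s], [s, c]]; the difference of two
   of them has determinant [c^2 + s^2], so it kills a nonzero vector only if it
   vanishes. *)
Lemma SO2_eq (A B : 'M[R]_2) (u : 'cV[R]_2) :
  A^T *m A = 1%:M -> \det A = 1 -> B^T *m B = 1%:M -> \det B = 1 ->
  u != 0 -> A *m u = B *m u -> A = B.
Proof.
have SO2E (C : 'M[R]_2) : C^T *m C = 1%:M -> \det C = 1 ->
    C ord_max ord_max = C ord0 ord0 /\ C ord_max ord0 = - C ord0 ord_max.
  move=> oC dC.
  (* For a matrix of SO(2) the transpose and the adjugate are both the inverse; comparing entries
     gives the two relations. *)
  have CV : C^T = \adj C.
    by rewrite -[\adj C]mul1mx -oC -mulmxA mul_mx_adj dC mulmx1.
  have := congr1 (fun M : 'M[R]_2 => M ord0 ord0) CV.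
  have := congr1 (fun M : 'M[R]_2 => M ord0 ord_max) CV.
  rewrite !mxE /cofactor !det_mx11 !mxE /= => h1 h2.
  split; [rewrite h2|rewrite h1]; rewrite ?expr0 ?expr1 ?mul1r ?mulN1r.
    by congr (C _ _); apply: val_inj.
  by congr (- C _ _); apply: val_inj.
move=> oA dA oB dB u0 ABu.
have [A1 A2] := SO2E _ oA dA; have [B1 B2] := SO2E _ oB dB.
have /(congr1 (fun M : 'cV[R]_2 => (M ord0 ord0, M ord_max ord0))) [] := ABu.
rewrite !mxE !big_ord_recl !big_ord0 !addr0.
rewrite (_ : lift ord0 ord0 = ord_max :> 'I_2) ?A1 ?A2 ?B1 ?B2; last exact: val_inj.
set a := A ord0 ord0; set b := A ord0 ord_max.
set c := B ord0 ord0; set d := B ord0 ord_max.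
set s := u ord0 ord0; set t := u ord_max ord0 => e1 e2.
have st : s ^+ 2 + t ^+ 2 != 0.
  apply: contra u0; rewrite paddr_eq0 ?sqr_ge0 // !sqrf_eq0 => /andP[/eqP s0 /eqP t0].
  apply/eqP/matrixP => i j; rewrite mxE ord1.
  by case: (ord2E i) => ->.
have pE : (a - c) * (s ^+ 2 + t ^+ 2) =
    s * ((a * s + b * t) - (c * s + d * t)) +
    t * ((- b * s + a * t) - (- d * s + c * t)) by ring.
have qE : (b - d) * (s ^+ 2 + t ^+ 2) =
    t * ((a * s + b * t) - (c * s + d * t)) -
    s * ((- b * s + a * t) - (- d * s + c * t)) by ring.
move/eqP: pE; move/eqP: qE; rewrite e1 e2 !subrr !mulr0 subrr addr0.
rewrite !mulf_eq0 (negbTE st) !orbF !subr_eq0 => /eqP bd /eqP ac.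
by apply/matrixP => i j; case: (ord2E i) => ->; case: (ord2E j) => ->;
  rewrite ?A1 ?A2 ?B1 ?B2 -/a -/b -/c -/d ?ac ?bd.
Qed.

(** The rotation parts agree on the nonzero vector [y - z], so they are equal by [SO2_eq]; one point
    then fixes the translation part. *)
Lemma Gamma_eq2 g h y z : Gamma g -> Gamma h -> y != z ->
  pact g y = pact h y -> pact g z = pact h z -> g = h.
Proof.
move=> Gg Gh yz gy gz.
have e2 : g.2 = h.2.
  case: (Gg) (Gh) => og dg [oh dh].
  apply: (@SO2_eq _ _ (y - z)); rewrite ?subr_eq0 //.
  have := congr2 (fun a b => a - b) gy gz; rewrite /pact -!mulmxBr.
  have E a : y + a - (z + a) = y - z by rewrite opprD addrACA subrr addr0.
  by rewrite !E.
move: gy; rewrite /pact e2 => /(congr1 (mulmx h.2^T)); rewrite !mulmxA.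
case: Gh => -> _; rewrite !mul1mx => /addrI e1.
by case: g h e1 e2 {Gg gz} => [? ?] [? ?] /= -> ->.
Qed.

End Isometries.

(** * The tiling metric *)

Section TilingMetric.
Variable R : realType.
Implicit Types (k : 'cV[R]_2 * 'M[R]_2) (u v y : 'cV[R]_2) (e r : R).
Implicit Types (t : set 'cV[R]_2) (T : tiles R).

(* One small isometry suffices to compare two tilings, and the size of the
   isometry and the radius of agreement are better kept apart: the pairs
   [(e, r)] generate the same uniformity as [tiling_dist]. *)
Definition close e r T T' : Prop :=
  exists k, [/\ Gamma k, gnorm k < e & patch (act k T) 0 r = patch T' 0 r].

Lemma patch_eqP r T T' : patch T 0 r = patch T' 0 r <->
  forall t, t `<=` eball 0 r -> (T t <-> T' t).
Proof.
split=> [/seteqP[TT' T'T] t tr|h].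
  split=> [Tt|Tt]; first by case: (TT' t).
  by case: (T'T t).
by apply/seteqP; split=> t [/h h' tr]; split=> //; apply/h'.
Qed.

Lemma eball0E r y : eball 0 r y = (frob y < r) :> Prop.
Proof. by rewrite /eball /= subr0. Qed.

Lemma sub_eball0 r r' : r <= r' -> eball 0 r `<=` eball (0 : 'cV[R]_2) r'.
Proof. by move=> rr y; rewrite !eball0E => /lt_le_trans; apply. Qed.

Lemma tact_sub_eball0 k t e r : Gamma k -> gnorm k <= e ->
  t `<=` eball 0 (r - e) -> tact k t `<=` eball 0 r.
Proof.
move=> Gk ke tr _ [y /tr yr <-]; move: yr; rewrite !eball0E => yr.
have := pact_norm y Gk; move: yr ke; lra.
Qed.

Lemma act_ginv_mem k T t : Gamma k -> act (ginv k) T t <-> T (tact k t).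
Proof.
move=> Gk; have Gk' := Gamma_inv Gk.
by rewrite -[t in X in X <-> _](tactK t Gk) act_mem.
Qed.

Lemma act_memV k T t : Gamma k -> act k T t <-> T (tact (ginv k) t).
Proof.
by move=> Gk; rewrite -[t in X in X <-> _](tactKV t Gk) act_mem.
Qed.

Lemma close_le e e' r r' T T' : e <= e' -> r' <= r ->
  close e r T T' -> close e' r' T T'.
Proof.
move=> ee rr [k [Gk ke /patch_eqP kT]]; exists k; split => //.
  exact: lt_le_trans ee.
by apply/patch_eqP => t tr; apply: kT; apply: subset_trans (sub_eball0 rr).
Qed.

(** Undo [g'] after applying [g]; since [g'] may push a tile outwards by [e], the radius of
    agreement shrinks by [e]. *)
Lemma within_close e T T' : tiling_within e T T' ->
  close (e + e) (e^-1 - e) T T'.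
Proof.
move=> [g [g' [Gg Gg' ge g'e /patch_eqP gT]]].
exists (gmul (ginv g') g); split; first exact/Gamma_mul/Gg/Gamma_inv.
  apply: le_lt_trans (gnorm_mul (Gamma_inv Gg') Gg) _.
  by rewrite gnorm_inv // ltrD.
apply/patch_eqP => t tr; rewrite act_mul // act_ginv_mem // gT ?act_mem //.
by apply: tact_sub_eball0 (ltW g'e) tr.
Qed.

Lemma close_within e T T' : 0 < e -> close e e^-1 T T' -> tiling_within e T T'.
Proof.
move=> e0 [k [Gk ke kT]]; exists k, (Gamma1 R); split => //.
- exact: Gamma_1.
- by rewrite -/(gnorm _) gnorm1.
- by rewrite act1.
Qed.

Lemma close_refl e r T : 0 < e -> close e r T T.
Proof.
move=> e0; exists (Gamma1 R); split; first exact: Gamma_1.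
  by rewrite gnorm1.
by rewrite act1.
Qed.

(** Compose the isometries. A tile has to be pulled back by [k'] before the first agreement applies,
    which costs [e'] in the radius. *)
Lemma close_trans e e' r T2 T1 T3 : close e r T1 T2 -> close e' r T2 T3 ->
  close (e + e') (r - e') T1 T3.
Proof.
move=> [k [Gk ke /patch_eqP kT]] [k' [Gk' ke' /patch_eqP kT']].
exists (gmul k' k); split; first exact: Gamma_mul.
  by apply: le_lt_trans (gnorm_mul Gk' Gk) _; rewrite addrC ltrD.
have e'0 : 0 <= e' := le_trans (gnorm_ge0 k') (ltW ke').
apply/patch_eqP => t tr; rewrite act_mul // act_memV // kT; last first.
  by apply: tact_sub_eball0 tr; [exact: Gamma_inv|rewrite gnorm_inv // ltW].
rewrite -act_memV // kT' //; apply: subset_trans tr _; apply: sub_eball0.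
by rewrite lerBlDr lerDl.
Qed.

(** The comparing isometry is conjugated by the translation; the ball of agreement, now centred off
    the origin, contains a centred ball smaller by [frob v]. *)
Lemma close_translate e r v T T' : close e r T T' ->
  close (e * (1 + frob v)) (r - frob v) (translate v T) (translate v T').
Proof.
move=> [k [Gk ke /patch_eqP kT]]; have Gv := Gamma_trans v.
have Gv' := Gamma_trans (- v); have Gkv := Gamma_mul Gk Gv'.
exists (gmul (gtrans v) (gmul k (gtrans (- v)))); split.
- exact: Gamma_mul.
- apply: le_lt_trans (gnorm_conj v Gk) _; rewrite ltr_pM2r //.
  by rewrite ltr_wpDr ?frob_ge0.
apply/patch_eqP => t tr; rewrite !act_mul // -(translate_act (- v)).
rewrite translateD addNr translate0 act_memV // kT ?translate_act ?act_memV //.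
apply: tact_sub_eball0 tr; first exact: Gamma_inv.
by rewrite gnorm_inv // gnorm_trans.
Qed.

Lemma close_shift e r u T : frob u < e -> close e r T (translate u T).
Proof.
move=> ue; exists (gtrans u); split; first exact: Gamma_trans.
  by rewrite gnorm_trans.
by rewrite translate_act.
Qed.

(** The bound [e <= 1] excludes the default value 1 of [tiling_dist], so the distance is a genuine
    infimum. *)
Lemma tiling_dist_lt e T T' : e <= 1 -> tiling_dist T T' < e ->
  exists2 f, 0 < f < e & tiling_within f T T'.
Proof.
rewrite /tiling_dist; set S := (X in inf X) => e1; case: asboolP => [S0|_].
  case/inf_lt => // f [/andP[f0 f1] wf] fe; exists f => //; by rewrite f0.
by move=> /lt_le_trans /(_ e1); rewrite ltxx.
Qed.

Lemma within_tiling_dist e T T' : 0 < e < 1 -> tiling_within e T T' ->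
  tiling_dist T T' <= e.
Proof.
move=> e01 we; rewrite /tiling_dist; set S := (X in inf X).
have Se : S e by [].
case: asboolP => [_|[]]; last by exists e.
by apply: ge_inf => //; exists 0 => f [/andP[/ltW]].
Qed.

Lemma tiling_dist_close e r : 0 < e ->
  exists2 f, 0 < f & forall T T', tiling_dist T T' < f -> close e r T T'.
Proof.
(* [within_close] doubles the size and gives the radius [h^-1 - h]; the three bounds keep [h + h]
   below [e], [h] below 1 and [h^-1] above |r| + 1. *)
move=> e0; pose f := Num.min (e / 2) (Num.min 1 (`|r| + 1)^-1).
have r0 : 0 < `|r| + 1 by rewrite ltr_wpDl.
exists f; first by rewrite !lt_min divr_gt0 // ltr01 invr_gt0.
have f1 : f <= 1 by rewrite !ge_min lexx orbT.
move=> T T' /(tiling_dist_lt f1)[h /andP[h0]].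
rewrite !lt_min => /and3P[he h1 hr] /within_close.
apply: close_le; first by move: he; lra.
have : `|r| + 1 < h^-1 by rewrite -[ltLHS]invrK ltf_pV2 ?posrE ?invr_gt0.
have := ler_norm r; move: h1; lra.
Qed.

Lemma close_tiling_dist e : 0 < e ->
  exists f r, 0 < f /\ forall T T', close f r T T' -> tiling_dist T T' < e.
Proof.
(* Halving [e] makes the weak bound of [within_tiling_dist] strict, and 1/2 keeps [f] in the range
   where [tiling_within] counts. *)
move=> e0; pose f := Num.min (e / 2) (1 / 2).
have f0 : 0 < f by rewrite lt_min !divr_gt0.
exists f, f^-1; split=> // T T' /(close_within f0) /within_tiling_dist.
have f1 : f <= 1 / 2 by rewrite ge_min lexx orbT.
have fe : f <= e / 2 by rewrite ge_min lexx.
rewrite f0 /= => /(_ _) h; apply: le_lt_trans (h _) _; last by move: fe e0; lra.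
by move: f1; lra.
Qed.

Lemma tiling_dist_refl T e : 0 < e -> tiling_dist T T < e.
Proof.
move=> e0; have [f [r [f0 h]]] := close_tiling_dist e0.
exact/h/close_refl.
Qed.

Lemma tiling_within_sym e T T' : tiling_within e T T' -> tiling_within e T' T.
Proof. by move=> [g [g' [? ? ? ? ?]]]; exists g', g. Qed.

Lemma tiling_distC T T' : tiling_dist T T' = tiling_dist T' T.
Proof.
rewrite /tiling_dist.
have -> // : [set e : R | 0 < e < 1 /\ tiling_within e T T'] =
          [set e : R | 0 < e < 1 /\ tiling_within e T' T].
by apply/seteqP; split=> e [? /tiling_within_sym].
Qed.

Lemma tiling_dist_tri e : 0 < e -> exists2 f, 0 < f &
  forall T1 T2 T3, tiling_dist T1 T2 < f -> tiling_dist T2 T3 < f ->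
    tiling_dist T1 T3 < e.
Proof.
move=> e0; have [f [r [f0 h]]] := close_tiling_dist e0.
have f20 : 0 < f / 2 by rewrite divr_gt0.
have [f' f'0 h'] := tiling_dist_close (r + f / 2) f20.
exists f' => // T1 T2 T3 /h' c12 /h' c23; apply: h.
by apply: close_le (close_trans c12 c23); lra.
Qed.

(** Translate both tilings by [v], which scales the size by [1 + frob v], then shift the second one
    by the small vector [v' - v]. *)
Lemma tiling_dist_translate v e : 0 < e -> exists2 f, 0 < f &
  forall T1 T2 v', tiling_dist T1 T2 < f -> frob (v - v') < f ->
    tiling_dist (translate v T1) (translate v' T2) < e.
Proof.
move=> e0; have [f [r [f0 h]]] := close_tiling_dist e0.
have v0 : 0 < 1 + frob v by rewrite ltr_pwDl ?frob_ge0.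
have f20 : 0 < f / 2 / (1 + frob v) by rewrite !divr_gt0.
have [f' f'0 h'] := tiling_dist_close (r + f / 2 + frob v) f20.
exists (Num.min f' (f / 2)); first by rewrite lt_min f'0 divr_gt0.
move=> T1 T2 v'; rewrite lt_min => /andP[/h' c12 _].
rewrite lt_min => /andP[_ vv']; apply: h.
have {c12} := close_translate v c12; rewrite divfK ?gt_eqF // addrK => c12.
have := close_shift (r + f / 2) (translate v T2) (u := v' - v) (e := f / 2).
rewrite frobC => /(_ vv'); rewrite translateD addrNK => c23.
by apply: close_le (close_trans c12 c23); lra.
Qed.

End TilingMetric.

(** * Topology defined by a distance with a weak triangle inequality *)

Section WeakMetric.
Variables (R : realType).

(* Composing small isometries gives the triangle inequality for [tiling_dist]
   in this uniform [epsilon]-[delta] form, which is enough for balls to be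
   neighbourhoods. *)
Definition weak_metric (Y : Type) (d : Y -> Y -> R) : Prop :=
  [/\ forall a e, 0 < e -> d a a < e,
      forall a b, d a b = d b a &
      forall e : R, 0 < e -> exists2 f : R, 0 < f &
        forall a b c, d a b < f -> d b c < f -> d a c < e].

Section Space.
Variables (Y : Type) (d : Y -> Y -> R).
Hypothesis wd : weak_metric d.
Implicit Types (a b : metric_space d) (U A : set (metric_space d)).

Lemma metric_nbhs a U :
  nbhs a U <-> exists2 e : R, 0 < e & forall b, d a b < e -> U b.
Proof.
case: wd => drefl _ dtri; split=> [|[e e0 eU]].
  rewrite nbhsE => -[B [oB Ba] BU]; have [e e0 eB] := oB _ Ba.
  by exists e => // b /eB /BU.
rewrite nbhsE.
(* The points having a ball inside [U] form an open set, by the weak triangle inequality. *)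
exists [set b | exists2 e, 0 < e & forall c, d b c < e -> U c]; last first.
  by move=> b [f f0 fU]; apply/fU/drefl.
split; last by exists e.
move=> b [f f0 fU]; have [f' f'0 h] := dtri _ f0.
exists f' => // c bc; exists f' => // c' cc'; exact: fU (h _ _ _ bc cc').
Qed.

(** Induction on the list of colours: the ultrafilter contains the fibre of the first colour or its
    complement, and in the latter case that colour can be discarded. *)
Lemma ultra_finite_fiber (C : choiceType) (F : set_system Y) (A : set Y)
    (c : Y -> C) : UltraFilter F -> F A -> finite_set (c @` A) ->
  exists2 a, A a & F (A `&` [set b | c b = c a]).
Proof.
move=> UF FA /finite_seqP[s As].
have {As} sub : A `<=` [set b | c b \in s].
  by move=> b Ab; have : (c @` A) (c b) by [exists b]; rewrite As.
elim: s A FA sub => [|y s IH] A FA sub.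
  by have [b /sub] := filter_ex FA.
have [Fy|Fy] := in_ultra_setVsetC [set b | c b = y] UF.
  have FAy : F (A `&` [set b | c b = y]) by exact: filterI.
  have [a [Aa /= ca]] := filter_ex FAy.
  exists a => //; by rewrite ca.
have FAy : F (A `&` ~` [set b | c b = y]) by exact: filterI.
have [|a [Aa _] Fa] := IH _ FAy.
  by move=> b [/sub /=]; rewrite inE => /orP[/eqP|].
exists a => //; apply: filterS Fa => b [[]]; by split.
Qed.

(** Total boundedness is expressed by finite colourings with small colour classes. An ultrafilter
    then contains balls of every radius; any two of them meet, so their centres form a Cauchy
    sequence, and the ultrafilter converges to its limit. *)
Lemma metric_compact A :
  (forall e : R, 0 < e -> exists (C : choiceType) (c : Y -> C),
     finite_set (c @` A) /\ forall a b, A a -> A b -> c a = c b -> d a b < e) ->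
  (forall u, (forall k, A (u k)) -> metric_cauchy d u ->
     exists2 a, A a & metric_limit d u a) ->
  compact A.
Proof.
case: wd => drefl dC dtri tb cpl; rewrite compact_ultra => F UF FA.
have small (e : R) : 0 < e -> exists2 a, A a & F [set b | d a b < e].
  move=> /tb[C [c [fin cd]]]; have [a Aa Fa] := ultra_finite_fiber UF FA fin.
  exists a => //; apply: filterS Fa => b [Ab /= ba]; exact: cd.
have k0 k : 0 < k.+1%:R^-1 :> R by rewrite invr_gt0.
have [u uP] : {u : nat -> Y &
    forall k, A (u k) /\ F [set b | d (u k) b < k.+1%:R^-1]}.
  apply: (@choice _ _ (fun k a => A a /\ F [set b | d a b < k.+1%:R^-1])).
  by move=> k; have [a] := small _ (k0 k); exists a.
have near_small (e : R) : 0 < e -> exists N : nat, forall m : nat, (N <= m)%N ->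
    m.+1%:R^-1 < e.
  move=> e0; exists (Num.bound e^-1) => m Nm.
  rewrite -[ltRHS]invrK ltf_pV2 ?posrE ?invr_gt0 //.
  apply: lt_le_trans (archi_boundP _) _; first by rewrite invr_ge0 ltW.
  by rewrite ler_nat (leq_trans Nm).
have [||a Aa ua] := cpl u; first by move=> k; case: (uP k).
  move=> e /dtri[f f0 h]; have [N hN] := near_small _ f0.
  exists N => m k /hN mf /hN kf.
  have [_ Fm] := uP m; have [_ Fk] := uP k.
  have [b [/= mb kb]] := filter_ex (filterI Fm Fk).
  by apply: (h _ b); [exact: lt_trans mf|rewrite dC; exact: lt_trans kf].
exists a; split=> // U /metric_nbhs[e /dtri[f f0 h] eU].
have [N hN] := near_small _ f0; have [N' hN'] := ua _ f0.
have [_ Fm] := uP (maxn N N'); apply: filterS Fm => b /= mb; apply: eU.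
apply: (h _ (u (maxn N N'))); first by rewrite dC hN' ?leq_maxr.
exact: lt_trans mb (hN _ (leq_maxl _ _)).
Qed.

End Space.

Lemma metric_within_continuous (Y Z : Type) (d : Y -> Y -> R) (d' : Z -> Z -> R)
    (A : set (metric_space d)) (h : metric_space d -> metric_space d') :
  weak_metric d -> weak_metric d' ->
  (forall a, A a -> forall e : R, 0 < e -> exists2 f : R, 0 < f &
     forall b, A b -> d a b < f -> d' (h a) (h b) < e) ->
  {within A, continuous h}.
Proof.
move=> wd wd' hc; apply/subspace_continuousP => a Aa U.
move=> /(metric_nbhs wd')[e e0 eU]; have [f f0 fe] := hc _ Aa _ e0.
apply/(metric_nbhs wd); exists f => // b ab Ab; exact/eU/fe.
Qed.

Lemma metric_homeo (Y Z : Type) (d : Y -> Y -> R) (d' : Z -> Z -> R)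
    (U : set (metric_space d)) (f : metric_space d -> metric_space d') :
  weak_metric d -> weak_metric d' -> U !=set0 ->
  (forall a b, U a -> U b -> f a = f b -> a = b) ->
  (forall a, U a -> forall e : R, 0 < e -> exists2 r : R, 0 < r &
     forall b, U b -> d a b < r -> d' (f a) (f b) < e) ->
  (forall a, U a -> forall e : R, 0 < e -> exists2 r : R, 0 < r &
     forall b, U b -> d' (f a) (f b) < r -> d a b < e) ->
  homeo_onto_image f U.
Proof.
move=> wd wd' [y0 Uy0] finj fc fVc; split.
  exact: metric_within_continuous.
(* The default [y0], available because [U] is nonempty, is the value of the inverse outside the
   image. *)
pose h z := xget y0 [set y | U y /\ f y = z].
have hf y : U y -> h (f y) = y.
  move=> Uy; rewrite /h; case: xgetP => [y' _ [Uy' /finj->]//|/(_ y)[]].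
  by split.
exists h => //; apply: metric_within_continuous => // _ [a Ua <-] e e0.
have [r r0 hr] := fVc _ Ua _ e0; exists r => // _ [b Ub <-] ab.
by rewrite !hf //; exact: hr.
Qed.

Lemma metric_hausdorff (Y : Type) (d : Y -> Y -> R) : weak_metric d ->
  (forall a b, (forall e, 0 < e -> d a b < e) -> a = b) ->
  hausdorff_space (metric_space d).
Proof.
move=> wd dsep a b ab; apply: dsep => e e0.
case: (wd) => _ dC /(_ _ e0)[f f0 h].
have ball c : nbhs (c : metric_space d) [set z | d c z < f].
  by apply/metric_nbhs => //; exists f.
have [z [/= az bz]] := ab _ _ (ball a) (ball b).
by apply: h az _; rewrite dC.
Qed.

End WeakMetric.

(** * Symmetries of polygons *)

Section Polygons.
Variable R : realType.
Implicit Types (y z a b c u v : 'cV[R]_2) (P : set 'cV[R]_2) (D : R).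

Lemma frob_sqr2 v : frob v ^+ 2 = v ord0 ord0 ^+ 2 + v ord_max ord0 ^+ 2.
Proof.
rewrite frob_sqr -(pair_bigA _ (fun i j => v i j ^+ 2)) /=.
rewrite big_ord_recl big_ord1 !big_ord1.
by congr (_ + v _ _ ^+ 2); apply: val_inj.
Qed.

Lemma det_row_mx2 u v : \det (row_mx u v : 'M[R]_2) =
  u ord0 ord0 * v ord_max ord0 - v ord0 ord0 * u ord_max ord0.
Proof.
have Eu i : (row_mx u v : 'M[R]_2) i ord0 = u i ord0.
  by rewrite mxE; case: splitP => k //= _; rewrite [k]ord1.
have Ev i : (row_mx u v : 'M[R]_2) i ord_max = v i ord0.
  by rewrite mxE; case: splitP => k /=; rewrite [k]ord1.
have det2 (A : 'M[R]_2) :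
    \det A = A ord0 ord0 * A ord_max ord_max - A ord0 ord_max * A ord_max ord0.
  rewrite (expand_det_row _ ord0) big_ord_recl big_ord1.
  rewrite (_ : lift ord0 ord0 = ord_max :> 'I_2); last exact: val_inj.
  rewrite /cofactor !det_mx11 !mxE /=.
  rewrite (_ : lift ord0 0 = ord_max :> 'I_2); last exact: val_inj.
  rewrite (_ : lift ord_max 0 = ord0 :> 'I_2); last exact: val_inj.
  rewrite expr0 expr1; ring.
by rewrite det2 !Eu !Ev.
Qed.

Lemma nondegenerate_neq a b c : nondegenerate a b c ->
  [/\ a != b, b != c & a != c].
Proof.
rewrite /nondegenerate det_row_mx2 !mxE => h.
by split; apply: contraNneq h => e; apply/eqP; rewrite ?e; ring.
Qed.

(* Strict convexity of the squared distance to [z]: the deficit is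
   [s t |a - b|^2 + t u |b - c|^2 + s u |a - c|^2]. *)
Lemma dist_barycenter a b c z (s t u : R) : s + t + u = 1 ->
  frob (s *: a + t *: b + u *: c - z) ^+ 2 =
  s * frob (a - z) ^+ 2 + t * frob (b - z) ^+ 2 + u * frob (c - z) ^+ 2 -
  (s * t * frob (a - b) ^+ 2 + t * u * frob (b - c) ^+ 2 +
   s * u * frob (a - c) ^+ 2).
Proof.
by move=> stu; have -> : u = 1 - s - t; [rewrite -stu|rewrite !frob_sqr2 !mxE]; ring.
Qed.

Lemma triangle_dist a b c y z D : triangle a b c y ->
  frob (a - z) <= D -> frob (b - z) <= D -> frob (c - z) <= D ->
  frob (y - z) <= D.
Proof.
move=> [s [t [u [s0 t0 u0 stu ->]]]] az bz cz.
have D0 : 0 <= D := le_trans (frob_ge0 _) az.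
rewrite -(@ler_pXn2r _ 2) ?nnegrE ?frob_ge0 // dist_barycenter //.
have sq v : frob v <= D -> frob v ^+ 2 <= D ^+ 2.
  by move=> h; rewrite ler_pXn2r ?nnegrE ?frob_ge0.
have -> : D ^+ 2 = s * D ^+ 2 + t * D ^+ 2 + u * D ^+ 2.
  by rewrite -!mulrDl stu mul1r.
rewrite lerBlDr; apply: ler_wpDr.
  by rewrite !addr_ge0 // !mulr_ge0 ?sqr_ge0 ?frob_ge0.
by rewrite !lerD // ler_wpM2l // sq.
Qed.

(** When the bound is attained the deficit in [dist_barycenter] vanishes; the sides have positive
    length, so every product of two weights is zero and a single weight survives. *)
Lemma triangle_dist_eq a b c y z D : nondegenerate a b c -> triangle a b c y ->
  frob (a - z) <= D -> frob (b - z) <= D -> frob (c - z) <= D ->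
  frob (y - z) = D -> [\/ y = a, y = b | y = c].
Proof.
move=> nabc [s [t [u [s0 t0 u0 stu yE]]]] az bz cz yz.
have [ab bc ac] := nondegenerate_neq nabc.
have D0 : 0 <= D := le_trans (frob_ge0 _) az.
have sq v : frob v <= D -> frob v ^+ 2 <= D ^+ 2.
  by move=> h; rewrite ler_pXn2r ?nnegrE ?frob_ge0.
have pos v v' : v != v' -> 0 < frob (v - v') ^+ 2.
  move=> h; rewrite exprn_gt0 // lt_neqAle frob_ge0 andbT eq_sym.
  by apply: contra h => /eqP /frob_eq0 /eqP; rewrite subr_eq0.
have zero k v v' : v != v' -> k * frob (v - v') ^+ 2 = 0 -> k = 0.
  by move=> /pos h /eqP; rewrite mulf_eq0 (gt_eqF h) orbF => /eqP.
have : frob (y - z) ^+ 2 = D ^+ 2 by rewrite yz.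
rewrite yE dist_barycenter //.
have h1 : s * frob (a - z) ^+ 2 <= s * D ^+ 2 by rewrite ler_wpM2l ?sq.
have h2 : t * frob (b - z) ^+ 2 <= t * D ^+ 2 by rewrite ler_wpM2l ?sq.
have h3 : u * frob (c - z) ^+ 2 <= u * D ^+ 2 by rewrite ler_wpM2l ?sq.
have h4 : D ^+ 2 = s * D ^+ 2 + t * D ^+ 2 + u * D ^+ 2.
  by rewrite -!mulrDl stu mul1r.
have st0 : 0 <= s * t * frob (a - b) ^+ 2 by rewrite !mulr_ge0 ?sqr_ge0 ?frob_ge0.
have tu0 : 0 <= t * u * frob (b - c) ^+ 2 by rewrite !mulr_ge0 ?sqr_ge0 ?frob_ge0.
have su0 : 0 <= s * u * frob (a - c) ^+ 2 by rewrite !mulr_ge0 ?sqr_ge0 ?frob_ge0.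
move=> eqD.
have /(zero _ _ _ ab)/eqP : s * t * frob (a - b) ^+ 2 = 0.
  by move: h1 h2 h3 h4 st0 tu0 su0 eqD; lra.
have /(zero _ _ _ bc)/eqP : t * u * frob (b - c) ^+ 2 = 0.
  by move: h1 h2 h3 h4 st0 tu0 su0 eqD; lra.
have /(zero _ _ _ ac)/eqP : s * u * frob (a - c) ^+ 2 = 0.
  by move: h1 h2 h3 h4 st0 tu0 su0 eqD; lra.
rewrite !mulf_eq0.
have [s00|s1] := eqVneq s 0.
  move=> _ /orP[]/eqP e _; [constructor 3|constructor 2]; move: stu;
  by rewrite s00 e ?addr0 ?add0r => ->; rewrite ?scale0r scale1r ?addr0 ?add0r.
move=> /= /eqP u00 _ /eqP t00; constructor 1; move: stu.
by rewrite u00 t00 !addr0 => ->; rewrite !scale0r scale1r !addr0.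
Qed.

Lemma triangle_vertices a b c :
  [/\ triangle a b c a, triangle a b c b & triangle a b c c].
Proof.
split; [exists 1, 0, 0|exists 0, 1, 0|exists 0, 0, 1];
  by rewrite ler01 lexx !scale0r scale1r ?addr0 ?add0r.
Qed.

(** The witnesses are the corners of the triangles, their largest mutual distance and a pair
    realising it. Moving one end at a time to a corner shows that no two points of [P] are further
    apart, and strict convexity makes an end point of a diameter a corner. *)
Lemma polygon_diameter P : closed_polygon P ->
  exists (V : set 'cV[R]_2) (D : R) a b,
    [/\ finite_set V, [/\ P a, P b, a != b & frob (a - b) = D],
        forall y z, P y -> P z -> frob (y - z) <= D &
        forall y z, P y -> P z -> frob (y - z) = D -> V y].
Proof.
move=> [m [a [b [c [nd PE]]]]].
pose vert (k : 'I_m.+1 * 'I_3) :=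
  if val k.2 is 0%N then a k.1 else if val k.2 is 1%N then b k.1 else c k.1.
have Pv k : P (vert k).
  rewrite PE; exists k.1 => //; rewrite /vert.
  have [] := triangle_vertices (a k.1) (b k.1) (c k.1).
  by case: (val k.2) => // -[].
have va k : a k = vert (k, inord 0) by rewrite /vert /= inordK.
have vb k : b k = vert (k, inord 1) by rewrite /vert /= inordK.
have vc k : c k = vert (k, inord 2) by rewrite /vert /= inordK.
pose f (kl : ('I_m.+1 * 'I_3) * ('I_m.+1 * 'I_3)) := frob (vert kl.1 - vert kl.2).
pose kl0 : ('I_m.+1 * 'I_3) * ('I_m.+1 * 'I_3) := ((ord0, ord0), (ord0, ord0)).
pose kl := [arg max_(i > kl0) f i]%O.
have klmax k l : frob (vert k - vert l) <= f kl.
  by rewrite /kl; case: Order.TotalTheory.arg_maxP => // i _ /(_ (k, l) isT).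
have le1 y k : P y -> frob (y - vert k) <= f kl.
  rewrite PE => -[j _ yj]; apply: triangle_dist yj _ _ _.
  - by rewrite va.
  - by rewrite vb.
  - by rewrite vc.
have le2 y z : P y -> P z -> frob (y - z) <= f kl.
  rewrite {1}PE => -[j _ yj] Pz; apply: triangle_dist yj _ _ _.
  - by rewrite frobC va le1.
  - by rewrite frobC vb le1.
  - by rewrite frobC vc le1.
exists (range vert), (f kl), (vert kl.1), (vert kl.2); split => //.
- exact/finite_image/finite_finset.
- split => //; apply: contraTneq (klmax (ord0, inord 0) (ord0, inord 1)) => e.
  rewrite /f e subrr frob0 -va -vb -ltNge lt_neqAle frob_ge0 andbT eq_sym.
  have [h _ _] := nondegenerate_neq (nd ord0).
  by apply: contra h => /eqP /frob_eq0 /eqP; rewrite subr_eq0.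
move=> y z; rewrite {1}PE => -[j _ yj] Pz.
case/(triangle_dist_eq (nd j) yj).
- by rewrite frobC va le1.
- by rewrite frobC vb le1.
- by rewrite frobC vc le1.
- by move=> ->; exists (j, inord 0).
- by move=> ->; exists (j, inord 1).
- by move=> ->; exists (j, inord 2).
Qed.

Lemma polygon_bounded P v : closed_polygon P -> P v ->
  exists2 D, 0 < D & forall y, P y -> frob (y - v) < D.
Proof.
move=> /polygon_diameter[V [D [a [b [_ [Pa Pb ab abD] h _]]]]] Pv.
have D0 : 0 <= D by rewrite -abD frob_ge0.
exists (D + 1); first by rewrite ltr_wpDl.
by move=> y Py; apply: le_lt_trans (h _ _ Py Pv) _; rewrite ltrDl.
Qed.

(* An isometry carrying [P] onto [Q] sends a diameter of [P] to a diameter of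
   [Q], whose end points are vertices of [Q], and it is determined by the images
   of two distinct points. *)
Lemma polygon_isometries_finite P Q : closed_polygon P -> closed_polygon Q ->
  finite_set [set g : 'cV[R]_2 * 'M[R]_2 | Gamma g /\ tact g P = Q].
Proof.
move=> /polygon_diameter[_ [D [a [b [_ [Pa Pb ab abD] Pd _]]]]].
move=> /polygon_diameter[V [D' [a' [b' [Vfin [Qa' Qb' _ ab'D] Qd QV]]]]].
pose f (g : 'cV[R]_2 * 'M[R]_2) := (pact g a, pact g b).
set G := (X in finite_set X).
have inV g : G g -> (V `*` V) (f g).
  move=> [Gg gPQ].
  have Qg y : P y -> Q (pact g y) by move=> Py; rewrite -gPQ; exists y.
  have DD' : D = D'.
    apply/eqP; rewrite eq_le; apply/andP; split.
      by rewrite -abD -(pact_dist _ _ Gg) Qd //; apply: Qg.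
    move: Qa' Qb' ab'D; rewrite -{1 2}gPQ => -[y Py <-] [z Pz <-].
    by rewrite pact_dist // => <-; exact: Pd.
  split => /=.
    by apply: (QV _ (pact g b)); rewrite ?pact_dist ?abD //; apply: Qg.
  by apply: (QV _ (pact g a)); rewrite ?pact_dist 1?frobC ?abD //; apply: Qg.
have finj g h : G g -> G h -> f g = f h -> g = h.
  by move=> [Gg _] [Gh _] [ga gb]; apply: Gamma_eq2 ab ga gb.
have /finite_image : finite_set ((V `*` V) `&` f @` G).
  exact/finite_setIl/finite_setX.
move=> /(_ _ (fun w => xget (Gamma1 R) [set g | G g /\ f g = w])).
apply: sub_finite_set => g Gg; exists (f g); first by split; [exact: inV|exists g].
case: xgetP => [h _ [Gh /finj->]//|/(_ g)[]]; by split.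
Qed.

End Polygons.

(** * Punctures *)

Lemma finite_pos_lb (R : realType) (I : Type) (A : set I) (f : I -> R) :
  finite_set A -> (forall a, A a -> 0 < f a) ->
  exists2 r : R, 0 < r & forall a, A a -> r <= f a.
Proof.
move=> /(finite_image f)/finite_seqP[s As] f0.
have s0 y : y \in s -> 0 < y.
  move=> ys; have [a Aa <-] : (f @` A) y by rewrite As.
  exact: f0.
suff [r r0 hr] : exists2 r : R, 0 < r & forall y, y \in s -> r <= y.
  exists r => // a Aa; apply: hr; have : (f @` A) (f a) by exists a.
  by rewrite As.
elim: s s0 {As} => [|y s IH] s0; first by exists 1.
have [|r r0 hr] := IH; first by move=> z zs; apply: s0; rewrite inE zs orbT.
exists (Num.min y r); first by rewrite lt_min r0 s0 // mem_head.
move=> z; rewrite inE => /orP[/eqP ->|/hr rz]; first by rewrite ge_min lexx.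
by rewrite ge_min rz orbT.
Qed.

Section Punctures.
Variables (R : realType) (n : nat) (p : 'I_n -> set 'cV[R]_2).
Variable x : 'I_n -> 'cV[R]_2.
Hypothesis polygon_p : forall i, closed_polygon (p i).
Hypothesis puncture_p : puncturing p x.
Implicit Types (g k : 'cV[R]_2 * 'M[R]_2) (u v w y : 'cV[R]_2) (e r : R).
Implicit Types (t : set 'cV[R]_2) (T : tiles R).

Definition proto_tiled T : Prop :=
  (forall t, T t -> exists g i, Gamma g /\ t = tact g (p i)) /\
  (forall t t', T t -> T t' -> t <> t' -> interior t `&` interior t' = set0).

Definition puncture_of T v : Prop := exists2 t, T t & is_puncture p x t v.

Lemma eball_tact g t v r : Gamma g -> eball v r `<=` t ->
  eball (pact g v) r `<=` tact g t.
Proof.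
move=> Gg vt y gvy; exists (pact (ginv g) y); last by rewrite pactKV.
by apply: vt; rewrite /eball /= -(pact_dist _ _ Gg) pactKV.
Qed.

Lemma interior_tact g t v : Gamma g ->
  interior (tact g t) v -> interior t (pact (ginv g) v).
Proof.
move=> Gg /nbhs_eball[r r0 vt]; apply/nbhs_eball; exists r => //.
by rewrite -(tactK t Gg); apply: eball_tact => //; exact: Gamma_inv.
Qed.

Lemma proto_tiled_act g T : Gamma g -> proto_tiled T -> proto_tiled (act g T).
Proof.
move=> Gg [Tp Tdisj]; split=> [_ [t Tt <-]|_ _ [t Tt <-] [t' Tt' <-] tt'].
  have [h [i [Gh ->]]] := Tp _ Tt; exists (gmul g h), i.
  by split; [exact: Gamma_mul|rewrite tact_mul].
apply/seteqP; split=> // y [/(interior_tact Gg) yt /(interior_tact Gg) yt'].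
have : (interior t `&` interior t') (pact (ginv g) y) by [].
by rewrite Tdisj // => e; apply: tt'; rewrite e.
Qed.

Lemma proto_tiled_translate v T : proto_tiled T -> proto_tiled (translate v T).
Proof. by rewrite translate_act; apply: proto_tiled_act; exact: Gamma_trans. Qed.

Lemma is_puncture_act g t v : Gamma g -> is_puncture p x t v ->
  is_puncture p x (tact g t) (pact g v).
Proof.
move=> Gg [h [i [Gh -> ->]]]; exists (gmul g h), i.
by rewrite tact_mul // pact_mul //; split=> //; exact: Gamma_mul.
Qed.

Lemma puncture_of_translate u T v : puncture_of T v ->
  puncture_of (translate u T) (v + u).
Proof.
move=> [t Tt tv]; rewrite translate_act -pact_trans.
have Gu := Gamma_trans u.
exists (tact (gtrans u) t); first exact/act_mem.
exact: is_puncture_act.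
Qed.

Lemma inner_radius : exists2 rho : R, 0 < rho &
  forall t v, is_puncture p x t v -> eball v rho `<=` t.
Proof.
have [f fP] : {f : 'I_n -> R & forall i, 0 < f i /\ eball (x i) (f i) `<=` p i}.
  apply: (@choice _ _ (fun i r => 0 < r /\ eball (x i) r `<=` p i)) => i.
  by have [/nbhs_eball[r r0 h] _] := puncture_p i; exists r.
have [|r r0 hr] := @finite_pos_lb R _ setT f (@finite_finset _ _).
  by move=> i _; case: (fP i).
exists r => // t v [g [i [Gg -> ->]]]; apply: eball_tact => // y yx.
by have [_] := fP i; apply; apply: lt_le_trans yx (hr _ _).
Qed.

Lemma outer_radius : exists2 D : R, 0 < D &
  forall t v, is_puncture p x t v -> t `<=` eball v D.
Proof.
have px i : p i (x i).
  by have [/interior_subset] := puncture_p i.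
have [f fP] : {f : 'I_n -> R & forall i, 0 < f i /\ p i `<=` eball (x i) (f i)}.
  apply: (@choice _ _ (fun i r => 0 < r /\ p i `<=` eball (x i) r)) => i.
  by have [D] := polygon_bounded (polygon_p i) (px i); exists D.
have [|r r0 hr] := @finite_pos_lb R _ setT (fun i => (f i)^-1) (@finite_finset _ _).
  by move=> i _; rewrite invr_gt0; case: (fP i).
exists r^-1; first by rewrite invr_gt0.
move=> t v [g [i [Gg -> ->]]] _ [y /(fun h => (fP i).2 _ h) yi <-].
rewrite /eball /= pact_dist //; apply: lt_le_trans yi _.
by rewrite -[leLHS]invrK lef_pV2 ?posrE ?invr_gt0 ?hr //; case: (fP i).
Qed.

(** The disc of radius [rho] about a puncture lies in its tile, so [v] would be interior to both
    tiles, which distinct tiles forbid. *)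
Lemma near_punctures_same_tile : exists2 rho : R, 0 < rho &
  forall T t t' v v', proto_tiled T -> T t -> T t' -> is_puncture p x t v ->
    is_puncture p x t' v' -> frob (v - v') < rho -> t = t'.
Proof.
have [rho rho0 inner] := inner_radius; exists rho => //.
move=> T t t' v v' [_ Tdisj] Tt Tt' tv tv' vv'; apply: contrapT => tt'.
have /seteqP[/(_ v) h _] := Tdisj _ _ Tt Tt' tt'; apply: h; split.
  apply: interior_eball (inner _ _ tv) _; by rewrite /eball /= subrr frob0.
exact: interior_eball (inner _ _ tv') _.
Qed.

(* A tile may have several punctures when its shape has symmetries, but the
   symmetries are finite in number, so the punctures stay separated. *)
Lemma punctures_separated : exists2 delta : R, 0 < delta &
  forall T v w, proto_tiled T -> puncture_of T v -> puncture_of T w ->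
    frob (v - w) < delta -> v = w.
Proof.
have [rho rho0 same] := near_punctures_same_tile.
have [f fP] : {f : 'I_n * 'I_n -> R & forall ij, 0 < f ij /\
    forall g, Gamma g -> tact g (p ij.2) = p ij.1 ->
      frob (x ij.1 - pact g (x ij.2)) < f ij -> x ij.1 = pact g (x ij.2)}.
  apply: (@choice _ _ (fun (ij : 'I_n * 'I_n) r => 0 < r /\
    forall g, Gamma g -> tact g (p ij.2) = p ij.1 ->
      frob (x ij.1 - pact g (x ij.2)) < r -> x ij.1 = pact g (x ij.2))).
  move=> [i j] /=.
  (* [S] collects the isometries of [p j] onto [p i] that do not match the punctures; being finite,
     it leaves a positive gap. *)
  pose S := [set g : 'cV[R]_2 * 'M[R]_2 | Gamma g /\ tact g (p j) = p i] `&`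
    [set g | x i <> pact g (x j)].
  have Sfin : finite_set S by exact/finite_setIl/polygon_isometries_finite.
  have [|r r0 hr] := @finite_pos_lb R _ S (fun g => frob (x i - pact g (x j))) Sfin.
    move=> g [_ /= ne]; rewrite lt_neqAle frob_ge0 andbT eq_sym; apply/eqP.
    by move=> /frob_eq0 /eqP; rewrite subr_eq0 => /eqP.
  exists r; split=> // g Gg gp gx; apply: contrapT => ne.
  by have := hr g; rewrite leNgt gx /= => /(_ _)/negP h; apply: h.
have [|r r0 hr] := @finite_pos_lb R _ setT f (@finite_finset _ _).
  by move=> i _; case: (fP i).
exists (Num.min rho r); first by rewrite lt_min rho0.
move=> T v w gT [t Tt tv] [t' Tt' tw]; rewrite lt_min => /andP[vw1 vw2].
have tt' := same _ _ _ _ _ gT Tt Tt' tv tw vw1.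
case: tv tw tt' vw2 => g [i [Gg -> ->]] [h [j [Gh -> ->]]] gh.
have Gg' := Gamma_inv Gg.
rewrite -(pact_dist _ _ Gg') pactK // -pact_mul // => xx.
have [_ /(_ (gmul (ginv g) h))] := fP (i, j); rewrite tact_mul // -gh tactK //=.
rewrite pact_mul // in xx *.
move=> ->//; first by rewrite pactKV.
  exact: Gamma_mul.
exact: lt_le_trans xx (hr (i, j) I).
Qed.

(** The small isometry matching the two tilings carries the puncture along. The tile stays within
    [frob v + 1 + D] of the origin, [e1] more leaves room for the isometry, and [pact_move] bounds
    the motion of the puncture by [e]. *)
Lemma puncture_transfer v e : 0 < e -> exists2 f : R, 0 < f &
  forall T T' v', puncture_of T v' -> frob (v' - v) <= 1 ->
    tiling_dist T T' < f -> exists2 w, puncture_of T' w & frob (w - v') < e.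
Proof.
move=> e0; have [D D0 outer] := outer_radius.
have v0 : 0 < 2 + frob v by rewrite ltr_wpDr ?frob_ge0.
pose e1 := e / (2 + frob v); have e10 : 0 < e1 by rewrite divr_gt0.
have [f f0 h] := tiling_dist_close (frob v + 1 + D + e1) e10.
exists f => // T T' v' [t Tt tv'] vv' /h[k [Gk ke /patch_eqP kT]].
have v'v : frob v' <= frob v + 1.
  by apply: le_trans (frob_trD v' v) _; rewrite lerD2l.
exists (pact k v').
  exists (tact k t); last exact: is_puncture_act.
  apply/kT; last by exists t.
  apply: (tact_sub_eball0 Gk (ltW ke)) => y /(outer _ _ tv').
  rewrite addrK eball0E /eball /= => yv'.
  by have := frob_trD y v'; move: yv' v'v; lra.
apply: le_lt_trans (pact_move v' Gk) _.
apply: le_lt_trans (_ : gnorm k * (2 + frob v) < _).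
  by rewrite ler_wpM2l ?gnorm_ge0 //; move: v'v; lra.
by rewrite -ltr_pdivlMr.
Qed.

(** Transfer yields punctures of [T] arbitrarily close to [v]; punctures being separated, those
    close enough are one and the same, hence equal to [v]. *)
Lemma puncture_limit T v : proto_tiled T ->
  (forall e, 0 < e -> exists T' v', [/\ puncture_of T' v',
     tiling_dist T' T < e & frob (v' - v) < e]) ->
  puncture_of T v.
Proof.
move=> gT lim; have [delta delta0 sep] := punctures_separated.
have near e : 0 < e -> exists2 w, puncture_of T w & frob (w - v) < e.
  move=> e0; have e20 : 0 < e / 2 by rewrite divr_gt0.
  have [f f0 h] := puncture_transfer v e20.
  have [|T' [v' [Tv' T'T v'v]]] := lim (Num.min f (Num.min 1 (e / 2))).
    by rewrite !lt_min f0 ltr01.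
  move: T'T v'v; rewrite !lt_min => /andP[T'T _] /and3P[_ v'1 v'e].
  have [w Tw wv'] := h _ _ _ Tv' (ltW v'1) T'T; exists w => //.
  by apply: le_lt_trans (frob_tri v' _ _) _; move: wv' v'e; lra.
have d20 : 0 < delta / 2 by rewrite divr_gt0.
have [w Tw wv] := near _ d20.
suff -> : v = w by [].
apply/eqP; rewrite eq_sym -subr_eq0; apply/eqP/frob_eq0/eqP.
rewrite eq_le frob_ge0 andbT leNgt; apply/negP => wv0.
have [|w' Tw'] := near (Num.min (delta / 2) (frob (w - v))).
  by rewrite lt_min d20.
rewrite lt_min => /andP[w'v]; suff -> : w' = w by rewrite ltxx.
apply: sep gT Tw' Tw _; apply: le_lt_trans (frob_tri v _ _) _.
by rewrite [frob (v - w)]frobC; move: w'v wv; lra.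
Qed.

Lemma Gamma_ext g k : Gamma g -> Gamma k -> pact g =1 pact k -> g = k.
Proof.
move=> Gg Gk gk; apply: (@Gamma_eq2 _ _ _ 0 (const_mx 1)) => //.
by apply/eqP => /matrixP /(_ ord0 ord0) /eqP; rewrite !mxE eq_sym oner_eq0.
Qed.

(** Every isometry of [t] onto [t'] comes, through [g] and [h], from the finite set of isometries of
    [p i] onto [p j]; the nonzero sizes in a finite set have a positive lower bound. *)
Lemma tile_isometries_discrete t t' :
  (exists g i, Gamma g /\ t = tact g (p i)) ->
  (exists g i, Gamma g /\ t' = tact g (p i)) ->
  exists2 e : R, 0 < e & forall k, Gamma k -> tact k t = t' -> gnorm k < e ->
    k = Gamma1 R.
Proof.
move=> [g [i [Gg ->]]] [h [j [Gh ->]]].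
have Gg' := Gamma_inv Gg; have Gh' := Gamma_inv Gh.
pose S := [set k : 'cV[R]_2 * 'M[R]_2 | Gamma k /\ tact k (p i) = p j].
pose f k := gmul h (gmul k (ginv g)).
have fin : finite_set (f @` S `&` [set k | gnorm k <> 0]).
  exact/finite_setIl/finite_image/polygon_isometries_finite.
have [|e e0 he] := @finite_pos_lb R _ _ (@gnorm R) fin.
  move=> k [_ /= k0]; rewrite lt_neqAle gnorm_ge0 andbT eq_sym; exact/eqP.
exists e => // k Gk kt ke; apply: gnorm_eq0; apply: contrapT => k0.
suff /he : (f @` S `&` [set k | gnorm k <> 0]) k by rewrite leNgt ke.
split=> //.
have Gkg := Gamma_mul Gk Gg.
have Gs : Gamma (gmul (ginv h) (gmul k g)) by exact: Gamma_mul.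
exists (gmul (ginv h) (gmul k g)).
  split=> //; rewrite !tact_mul // kt tactK //.
have Gsg := Gamma_mul Gs Gg'.
apply: Gamma_ext => //; first exact: Gamma_mul.
by move=> y; rewrite !pact_mul // !pactKV.
Qed.

(** Arbitrarily small isometries carry a tile of one tiling to tiles of the other. Nearness of the
    punctures makes the image one fixed tile, and by discreteness a small enough such isometry is
    the identity. *)
Lemma tiling_dist_eq T T' : proto_tiled T -> proto_tiled T' ->
  (forall e, 0 < e -> tiling_dist T T' < e) -> T = T'.
Proof.
suff sub T1 T2 : proto_tiled T1 -> proto_tiled T2 ->
    (forall e, 0 < e -> tiling_dist T1 T2 < e) -> T1 `<=` T2.
  move=> gT gT' d0; apply/seteqP; split; apply: sub => // e.
  by rewrite tiling_distC; exact: d0.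
move=> g1 g2 d0 t Tt; have [D D0 outer] := outer_radius.
have [rho rho0 same] := near_punctures_same_tile.
have [g [i [Gg tE]]] := g1.1 _ Tt; pose v := pact g (x i).
have tv : is_puncture p x t v by exists g, i.
have v0 : 0 < 1 + frob v by rewrite ltr_pwDl ?frob_ge0.
have near e : 0 < e -> exists k, [/\ Gamma k, gnorm k < e, T2 (tact k t) &
    gnorm k < rho / 2 / (1 + frob v)].
  move=> e0; pose e1 := Num.min e (rho / 2 / (1 + frob v)).
  have e10 : 0 < e1 by rewrite lt_min e0 !divr_gt0.
  have [f f0 h] := tiling_dist_close (frob v + D + e1) e10.
  have [k [Gk]] := h _ _ (d0 _ f0); rewrite lt_min => /andP[ke kr] /patch_eqP kT.
  exists k; split=> //; apply/kT; last by exists t.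
  have ke1 : gnorm k < e1 by rewrite lt_min ke.
  apply: (tact_sub_eball0 Gk (ltW ke1)) => y /(outer _ _ tv).
  rewrite addrK eball0E /eball /= => yv'.
  by have := frob_trD y v; move: yv'; lra.
have move k : Gamma k -> gnorm k < rho / 2 / (1 + frob v) ->
    frob (pact k v - v) < rho / 2.
  by move=> Gk kr; apply: le_lt_trans (pact_move v Gk) _; rewrite -ltr_pdivlMr.
have [k0 [Gk0 _ Tk0 k0r]] := near 1 ltr01.
have [e e0 he] := tile_isometries_discrete (g1.1 _ Tt) (g2.1 _ Tk0).
have [k [Gk ke Tk kr]] := near _ e0.
have kk0 : tact k t = tact k0 t.
  apply: same g2 Tk Tk0 (is_puncture_act Gk tv) (is_puncture_act Gk0 tv) _.
  apply: le_lt_trans (frob_tri v _ _) _; rewrite [ltRHS]splitr.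
  by rewrite ltrD ?move // frobC move.
by rewrite -[t]tact1 -(he _ Gk kk0 ke).
Qed.

End Punctures.

(** * The discrete hull *)

Lemma frob_coloring (R : realType) (m n : nat) (B e : R) : 0 < e ->
  exists (C : finType) (c : 'M[R]_(m, n) -> C), forall A A',
    frob A <= B -> frob A' <= B -> c A = c A' -> frob (A - A') < e.
Proof.
(* The mesh [d] is chosen so that [N * d] stays below [e]; the shift by [B] in [cell] makes the
   entries nonnegative before truncation. *)
move=> e0; pose N := (m * n)%N; pose d := e / N.+1%:R.
have d0 : 0 < d by rewrite divr_gt0.
pose K := Num.truncn ((B + B) / d).
pose cell (a : R) : 'I_K.+1 := inord (Num.truncn ((a + B) / d)).
exists ('M['I_K.+1]_(m, n) : finType), (map_mx cell) => A A' AB A'B cAA'.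
have bnd (A1 : 'M[R]_(m, n)) i j : frob A1 <= B ->
    0 <= (A1 i j + B) / d <= (B + B) / d.
  move=> /(le_trans (frob_entry A1 i j)); rewrite ler_norml => /andP[lo up].
  apply/andP; split; last by rewrite ler_pM2r ?invr_gt0 // lerD2r.
  by rewrite divr_ge0 ?(ltW d0) // -lerBlDr sub0r.
have inK (A1 : 'M[R]_(m, n)) i j : frob A1 <= B ->
    (Num.truncn ((A1 i j + B) / d) < K.+1)%N.
  by move=> /(bnd _ i j)/andP[_ h]; rewrite ltnS le_truncn.
have near i j : `|(A - A') i j| <= d.
  have /matrixP/(_ i j) := cAA'; rewrite !mxE => /(congr1 val).
  rewrite /= !inordK ?inK // => E.
  have [/andP[a0 _] /andP[a'0 _]] := (bnd _ i j AB, bnd _ i j A'B).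
  have /andP[l1 u1] := truncn_itv a0; have /andP[l2 u2] := truncn_itv a'0.
  rewrite -E in l2 u2.
  have -> : A i j - A' i j = ((A i j + B) / d - (A' i j + B) / d) * d.
    by rewrite -mulrBl divfK ?gt_eqF //; ring.
  rewrite normrM (gtr0_norm d0) ler_piMl ?(ltW d0) //.
  move: l1 u1 l2 u2; rewrite -addn1 natrD ler_norml => *; apply/andP; split; lra.
apply: le_lt_trans (frob_sum_entries _) _.
apply: le_lt_trans (_ : \sum_(i < m) \sum_(j < n) d < _).
  by apply: ler_sum => i _; apply: ler_sum => j _; exact: near.
rewrite !sumr_const !card_ord -mulr_natr -[d *+ n]mulr_natr -mulrA -natrM mulnC -/N.
by rewrite /d mulrAC ltr_pdivrMr // ltr_pM2l // ltr_nat.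
Qed.

Section Hull.
Variables (R : realType) (T0 : tiles R) (Omega : set (tiles R)) (n : nat).
Variables (p : 'I_n -> set 'cV[R]_2) (x : 'I_n -> 'cV[R]_2).
Hypothesis hullT : is_continuous_hull T0 Omega.
Hypothesis protop : prototiles_of p Omega.
Hypothesis flc : finite_local_complexity Omega.
Hypothesis punct : puncturing p x.
Implicit Types (u v w y : 'cV[R]_2) (e r : R).
Implicit Types (t : set 'cV[R]_2) (T : tiles R).

Lemma polygon_p i : closed_polygon (p i).
Proof. by case: protop. Qed.

Lemma Omega_proto_tiled T : Omega T -> proto_tiled p T.
Proof.
move=> OT; split; first by case: protop => _ _ h t; exact: h.
by case: (hullT.1 _ OT).
Qed.

(** The hull is given as a completion of the orbit of [T0]: approximate [T] by translates of [T0],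
    translate these, and identify their limit by [tiling_dist_eq]. *)
Lemma Omega_translate v T : Omega T -> Omega (translate v T).
Proof.
move=> OT; have [_ [sub dense cpl]] := hullT.
have k0 k : 0 < k.+1%:R^-1 :> R by rewrite invr_gt0.
have [b bP] : {b : nat -> tiles R & forall k,
    range (fun u => translate u T0) (b k) /\ tiling_dist T (b k) < k.+1%:R^-1}.
  apply: (@choice _ _ (fun k T' =>
    range (fun u => translate u T0) T' /\ tiling_dist T T' < k.+1%:R^-1)).
  by move=> k; have [T'] := dense _ OT _ (k0 k); exists T'.
have near e : 0 < e -> exists N : nat, forall m : nat, (N <= m)%N ->
    tiling_dist (translate v T) (translate v (b m)) < e.
  move=> e0; have [f f0 h] := tiling_dist_translate v e0.
  exists (Num.bound f^-1) => m Nm; apply: h; last by rewrite subrr frob0.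
  apply: lt_trans (bP m).2 _; rewrite -[ltRHS]invrK ltf_pV2 ?posrE ?invr_gt0 //.
  apply: lt_le_trans (archi_boundP _) _; first by rewrite invr_ge0 ltW.
  by rewrite ler_nat (leq_trans Nm).
have [||S OS lim] := cpl (fun k => translate v (b k)).
- move=> k; apply: sub; have [[u _ <-] _] := bP k.
  by exists (v + u) => //; rewrite translateD.
- move=> e /tiling_dist_tri[f f0 h]; have [N hN] := near _ f0.
  exists N => m k /hN Nm /hN; apply: h; by rewrite tiling_distC.
suff -> : translate v T = S by [].
apply: (tiling_dist_eq polygon_p punct).
- exact/proto_tiled_translate/Omega_proto_tiled.
- exact: Omega_proto_tiled.
move=> e /tiling_dist_tri[f f0 h]; have [N hN] := near _ f0.
have [N' hN'] := lim _ f0.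
apply: (h _ (translate v (b (maxn N N')))); first by rewrite hN ?leq_maxl.
by rewrite hN' ?leq_maxr.
Qed.

Local Notation X := (discrete_hull p x Omega).

Lemma discrete_hullP T : X T <-> Omega T /\ puncture_of p x T 0.
Proof. by []. Qed.

Lemma discrete_hull_translate v T : Omega T -> puncture_of p x T v ->
  X (translate (- v) T).
Proof.
move=> OT Tv; apply/discrete_hullP; split; first exact: Omega_translate.
by rewrite -(subrr v); exact: puncture_of_translate.
Qed.

(* By finite local complexity the patches around the origin are [act g P] with
   [P] in a finite set; comparing [g] with the isometry of a reference tiling
   having the same [P] leaves a bounded set of isometries, since both patches
   contain a tile at the origin. *)
Lemma close_coloring e r : 0 < e -> exists (C : choiceType) (c : tiles R -> C),
  finite_set (c @` X) /\
  forall T T', X T -> X T' -> c T = c T' -> close e r T T'.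
Proof.
move=> e0; have [D D0 outer] := outer_radius polygon_p punct.
have [rho rho0 inner] := inner_radius punct.
(* [D] leaves room for a tile punctured at the origin, [e] for the comparing isometry and |r| for
   the ball in question. *)
pose r' := D + e + `|r|.
have r'0 : 0 < r' by rewrite /r' ltr_wpDr // addr_gt0.
have [F Ffin FP] := flc r'0.
have [G GP] : {G : tiles R -> ('cV[R]_2 * 'M[R]_2) * tiles R & forall T, Omega T ->
    [/\ Gamma (G T).1, F (G T).2 & patch T 0 r' = act (G T).1 (G T).2]}.
  apply: (@choice _ _ (fun T (G : ('cV[R]_2 * 'M[R]_2) * tiles R) => Omega T ->
    [/\ Gamma G.1, F G.2 & patch T 0 r' = act G.1 G.2])) => T.
  have [OT|nOT] := pselect (Omega T); last by exists (Gamma1 R, T).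
  by have [g [P gP]] := FP T 0 OT; exists (g, P).
(* By [refP] the default [set0] is never taken at the patch attached to a tiling of [X]. *)
pose ref (P : tiles R) := xget set0 [set T | X T /\ (G T).2 = P].
pose h T := gmul (G T).1 (ginv (G (ref (G T).2)).1).
have refP T : X T -> X (ref (G T).2) /\ (G (ref (G T).2)).2 = (G T).2.
  move=> XT; rewrite /ref; case: xgetP => [T' _ //|/(_ T)[]]; by split.
have hG T : X T -> Gamma (h T).
  move=> XT; have [[OT' _] _] := refP _ XT.
  have [G1 _ _] := GP _ XT.1; have [G2 _ _] := GP _ OT'.
  exact/Gamma_mul/Gamma_inv.
pose B := r' + frob (1%:M : 'M[R]_2).
have hB1 T : X T -> frob (h T).1 <= B.
  move=> XT; have [XT' GE] := refP _ XT; set T' := ref _ in XT' GE.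
  have [G1 _ p1] := GP _ XT.1; have [G2 _ p2] := GP _ XT'.1.
  have [_ [t Tt t0]] := XT'.
  have tr' : t `<=` eball 0 r'.
    apply: subset_trans (outer _ _ t0) (sub_eball0 _).
    by rewrite /r' -addrA lerDl addr_ge0 // ltW.
  (* [h T] carries the central patch of the reference tiling to that of [T]. As the origin lies in
     [t], its image stays within [r'], which bounds the translation part. *)
  have : patch T 0 r' (tact (h T) t).
    have Ptt : patch T' 0 r' t by split.
    rewrite p1 -GE -/T' /h -/T' -(actK (G T').2 G2) -p2 -act_mul; last exact: Gamma_inv.
    exact/act_mem/Ptt/hG.
  move=> [_ /(_ (pact (h T) 0))]; rewrite eball0E => h0.
  have /h0 : tact (h T) t (pact (h T) 0).
    by exists 0 => //; apply: inner t0 _ _; rewrite /eball /= subrr frob0.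
  rewrite /pact add0r frob_orthol; last by case: (hG _ XT).
  by move=> /ltW /le_trans; apply; rewrite lerDl frob_ge0.
have hB2 T : X T -> frob (h T).2 <= B.
  move=> /hG [oh _]; rewrite -[(h T).2]mulmx1 frob_orthol //.
  by rewrite lerDr ltW.
have e20 : 0 < e / 2 by rewrite divr_gt0.
have [C1 [c1 c1P]] := @frob_coloring R 2 1 B _ e20.
have [C2 [c2 c2P]] := @frob_coloring R 2 2 B _ e20.
exists (tiles R * (C1 * C2))%type, (fun T => ((G T).2, (c1 (h T).1, c2 (h T).2))).
split.
  have : finite_set (F `*` [set: C1 * C2]).
    by apply: finite_setX => //; exact: finite_finset.
  apply: sub_finite_set => _ [T XT <-]; split=> //=.
  by have [] := GP _ XT.1.
move=> T T' XT XT' [GE /(c1P _ _ (hB1 _ XT) (hB1 _ XT')) d1].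
move=> /(c2P _ _ (hB2 _ XT) (hB2 _ XT')) d2.
have [G1 _ p1] := GP _ XT.1; have [G2 _ p2] := GP _ XT'.1.
have [[OR _] _] := refP _ XT; have [G3 _ _] := GP _ OR.
(* By right invariance this quotient has the size of the quotient of [h T'] by [h T], whose colours
   agree. *)
have ke : gnorm (gmul (G T').1 (ginv (G T).1)) < e.
  rewrite -(gmul_div G2 G1 G3) {1}GE -/(h T) -/(h T').
  rewrite gnorm_divr; [|exact: hG..].
  rewrite [ltRHS]splitr frobC [X in _ + X]frobC; exact: ltrD.
have Gk : Gamma (gmul (G T').1 (ginv (G T).1)) by exact/Gamma_mul/Gamma_inv.
have Gk' := Gamma_inv Gk.
exists (gmul (G T').1 (ginv (G T).1)); split=> //; apply/patch_eqP => t tr.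
have rr' : r <= r' - e.
  by have := ler_norm r; rewrite /r'; move: D0; lra.
have tr1 : t `<=` eball 0 r'.
  by apply: subset_trans tr (sub_eball0 _); move: rr' e0; lra.
have tr2 : tact (ginv (gmul (G T').1 (ginv (G T).1))) t `<=` eball 0 r'.
  apply: (@tact_sub_eball0 _ _ _ e) => //; first by rewrite gnorm_inv // ltW.
  by apply: subset_trans tr (sub_eball0 _).
have E1 : T' t <-> patch T' 0 r' t by split=> [Tt|[]//]; split.
rewrite E1 p2 -GE -(actK (G T).2 G1) -p1 -act_mul; last exact: Gamma_inv.
rewrite !act_memV //; by split=> [Tt|[]//]; split.
Qed.

End Hull.

(** * The étale equivalence relation *)

Section VectorLimits.
Variable R : realType.

Lemma real_cauchy_limit (a : nat -> R) :
  metric_cauchy (fun s t : R => `|s - t|) a ->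
  exists l, metric_limit (fun s t : R => `|s - t|) a l.
Proof.
move=> ca; have /cvg_ex[l al] : cvg (a @ \oo).
  apply: cauchy_cvg; apply: cauchy_exP => e /ca[N hN]; exists (a N).
  by exists N => // m /= Nm; exact: hN.
exists l => e e0; move/cvgrPdist_lt : al => /(_ _ e0)[N _ hN].
by exists N => m Nm; rewrite distrC; exact: hN.
Qed.

Lemma frob_cauchy_limit (u : nat -> 'cV[R]_2) :
  metric_cauchy (fun y z : 'cV[R]_2 => frob (y - z)) u ->
  exists v, metric_limit (fun y z : 'cV[R]_2 => frob (y - z)) u v.
Proof.
move=> cu.
have lim i : exists l, metric_limit (fun s t : R => `|s - t|) (fun k => u k i ord0) l.
  apply: real_cauchy_limit => e /cu[N hN]; exists N => m k Nm Nk.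
  apply: le_lt_trans (hN _ _ Nm Nk); apply: le_trans (frob_entry _ i ord0).
  by rewrite !mxE.
have [l0 hl0] := lim ord0; have [l1 hl1] := lim ord_max.
exists (\col_i (if i == ord0 then l0 else l1)) => e e0.
have e20 : 0 < e / 2 by rewrite divr_gt0.
have [N0 hN0] := hl0 _ e20; have [N1 hN1] := hl1 _ e20.
exists (maxn N0 N1) => m; rewrite geq_max => /andP[/hN0 h0 /hN1 h1].
apply: le_lt_trans (frob_sum_entries _) _.
rewrite big_ord_recl big_ord1 !big_ord1 !mxE /= [ltRHS]splitr.
rewrite (_ : lift ord0 ord0 = ord_max :> 'I_2); last exact: val_inj.
exact: ltrD.
Qed.

End VectorLimits.

Lemma tiling_dist_ge0 (R : realType) (T T' : tiles R) : 0 <= tiling_dist T T'.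
Proof.
rewrite /tiling_dist; case: asboolP => // S0; apply: lb_le_inf => //.
by move=> e [/andP[/ltW]].
Qed.

Section Etale.
Variables (R : realType) (T0 : tiles R) (Omega : set (tiles R)) (n : nat).
Variables (p : 'I_n -> set 'cV[R]_2) (x : 'I_n -> 'cV[R]_2).
Hypothesis hullT : is_continuous_hull T0 Omega.
Hypothesis protop : prototiles_of p Omega.
Hypothesis flc : finite_local_complexity Omega.
Hypothesis aper : strongly_aperiodic Omega.
Hypothesis punct : puncturing p x.

Local Notation X := (discrete_hull_space p x Omega).
Local Notation G := (R_punc_space p x Omega).
Local Notation hv := (@hull_val R n p x Omega).
Local Notation r := (rel_r (@R_punc_pr R n p x Omega)).
Local Notation s := (rel_s (@R_punc_pr R n p x Omega)).
Local Notation polyp := (polygon_p protop).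

Definition hull_dist (a b : X) : R := tiling_dist (hv a) (hv b).
Definition hull_rel_dist (c d : G) : R :=
  R_dist p x (hull_rel_val c) (hull_rel_val d).
Definition disp (c : G) : 'cV[R]_2 := displacement p x (hull_rel_val c).

Lemma weak_hull_dist : weak_metric hull_dist.
Proof.
split=> [a e|a b|e /tiling_dist_tri[f f0 h]]; first exact: tiling_dist_refl.
  exact: tiling_distC.
by exists f => // a b c; exact: h.
Qed.

Lemma hull_rel_distE c d :
  hull_rel_dist c d = hull_dist (r c) (r d) + frob (disp c - disp d).
Proof. by []. Qed.

Lemma hull_rel_dist_lt c d e : hull_rel_dist c d < e ->
  hull_dist (r c) (r d) < e /\ frob (disp c - disp d) < e.
Proof.
rewrite hull_rel_distE; have := tiling_dist_ge0 (hv (r c)) (hv (r d)).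
rewrite -/(hull_dist (r c) (r d)); have := frob_ge0 (disp c - disp d).
by move=> ? ? ?; split; lra.
Qed.

Lemma lt_hull_rel_dist c d e : hull_dist (r c) (r d) < e / 2 ->
  frob (disp c - disp d) < e / 2 -> hull_rel_dist c d < e.
Proof. by move=> h h'; rewrite hull_rel_distE [ltRHS]splitr ltrD. Qed.

Lemma weak_hull_rel_dist : weak_metric hull_rel_dist.
Proof.
have [drefl dC dtri] := weak_hull_dist.
split=> [c e e0|c d|e e0].
- by rewrite hull_rel_distE subrr frob0 addr0; exact: drefl.
- by rewrite !hull_rel_distE dC frobC.
have e20 : 0 < e / 2 by rewrite divr_gt0.
have [f f0 h] := dtri _ e20; exists (Num.min f (e / 2 / 2)).
  by rewrite lt_min f0 divr_gt0.
move=> a b c /hull_rel_dist_lt[ab ab'] /hull_rel_dist_lt[bc bc'].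
move: ab ab' bc bc'; rewrite !lt_min.
move=> /andP[ab _] /andP[_ ab'] /andP[bc _] /andP[_ bc'].
apply: lt_hull_rel_dist; first exact: h ab bc.
by apply: le_lt_trans (frob_tri (disp b) _ _) _; rewrite [ltRHS]splitr ltrD.
Qed.

Lemma R_punc_openP (U : set G) : open U <-> forall c, U c ->
  exists2 e : R, 0 < e & forall d, hull_rel_dist c d < e -> U d.
Proof. by []. Qed.

(** * Displacements and inverses of pairs *)

Lemma hull_Omega (a : X) : Omega (hv a).
Proof. by case: a => T [] . Qed.

Lemma hull_tiled (a : X) : proto_tiled p (hv a).
Proof. exact: (Omega_proto_tiled hullT protop (hull_Omega a)). Qed.

Lemma hull_origin (a : X) : puncture_of p x (hv a) 0.
Proof. by case: a => T []. Qed.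

Lemma hull_val_inj (a b : X) : hv a = hv b -> a = b.
Proof.
case: a b => [T hT] [S hS] /= TS; case: _ / TS in hS *.
by congr exist; exact: Prop_irrelevance.
Qed.

Lemma translate_inj T u v : Omega T -> translate u T = translate v T -> u = v.
Proof.
move=> OT uv; apply/eqP; rewrite -subr_eq0; apply/negPn/negP => /(aper OT); apply.
by rewrite addrC -translateD uv translateD addNr translate0.
Qed.

Lemma hull_relP (a b : X) : @hull_rel R n p x Omega (a, b) <->
  exists2 v, puncture_of p x (hv a) v & hv b = translate (- v) (hv a).
Proof.
split=> [[_ [v [av abv]]]|[v av bE]]; first by exists v.
by split; [case: a {av bE}|exists v].
Qed.

(** The [xget] in [displacement] returns [v] itself, since two displacements of one pair would
    differ by a period. *)
Lemma disp_mk (a b : X) v : puncture_of p x (hv a) v ->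
  hv b = translate (- v) (hv a) ->
  exists2 c : G, R_punc_pr c = (a, b) & disp c = v.
Proof.
move=> av bE; have hab : @hull_rel R n p x Omega (a, b) by apply/hull_relP; exists v.
exists (exist _ (a, b) hab) => //; rewrite /disp /displacement.
case: xgetP => [w _ [_ /= wE]|/(_ v)[]]; last by split.
by apply: oppr_inj; apply: (translate_inj (hull_Omega a)); rewrite -wE -bE.
Qed.

Lemma disp_ex (a : X) v : puncture_of p x (hv a) v ->
  exists2 c : G, r c = a & disp c = v.
Proof.
move=> av.
have Xb := discrete_hull_translate hullT protop punct (hull_Omega a) av.
have [c cE cv] := disp_mk (b := exist _ _ Xb) av erefl.
by exists c => //; rewrite /rel_r cE.
Qed.

Lemma dispP (c : G) :
  puncture_of p x (hv (r c)) (disp c) /\ hv (s c) = translate (- disp c) (hv (r c)).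
Proof.
have [v av bE] : exists2 v, puncture_of p x (hv (r c)) v &
    hv (s c) = translate (- v) (hv (r c)).
  by case: c => [[a b] hab]; apply/hull_relP.
rewrite /disp /displacement; case: xgetP => [w _ [aw wE]//|/(_ v)[]].
by split.
Qed.

Lemma R_punc_pr_inj (c d : G) : R_punc_pr c = R_punc_pr d -> c = d.
Proof.
case: c d => [ab hab] [cd hcd] /= E; case: _ / E in hcd *.
by congr exist; exact: Prop_irrelevance.
Qed.

Lemma disp_inj (c d : G) : r c = r d -> disp c = disp d -> c = d.
Proof.
move=> rE vE; apply: R_punc_pr_inj; rewrite [LHS]surjective_pairing.
rewrite [RHS]surjective_pairing -/(r c) -/(r d) -/(s c) -/(s d) rE; congr pair.
by apply: hull_val_inj; rewrite (dispP c).2 (dispP d).2 rE vE.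
Qed.

Lemma hull_rel_sym_ex (c : G) :
  exists d : G, R_punc_pr d = (s c, r c) /\ disp d = - disp c.
Proof.
have [cv sE] := dispP c.
have [||d dE dv] := @disp_mk (s c) (r c) (- disp c).
- by have := puncture_of_translate (- disp c) (hull_origin (r c)); rewrite add0r sE.
- by rewrite opprK sE translateD addrN translate0.
by exists d.
Qed.

(** The groupoid inverse on [G], through which properties of [s] are reduced to those of [r]. *)
Definition swap (c : G) : G := projT1 (cid (hull_rel_sym_ex c)).

Lemma swap_pr c : R_punc_pr (swap c) = (s c, r c).
Proof. by rewrite /swap; case: cid => d []. Qed.

Lemma swap_disp c : disp (swap c) = - disp c.
Proof. by rewrite /swap; case: cid => d []. Qed.

Lemma r_swap c : r (swap c) = s c. Proof. by rewrite /rel_r swap_pr. Qed.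
Lemma s_swap c : s (swap c) = r c. Proof. by rewrite /rel_s swap_pr. Qed.

Lemma swapK c : swap (swap c) = c.
Proof.
by apply: disp_inj; rewrite ?r_swap ?s_swap // !swap_disp opprK.
Qed.

Lemma swap_continuous c e : 0 < e -> exists2 f : R, 0 < f &
  forall d, hull_rel_dist c d < f -> hull_rel_dist (swap c) (swap d) < e.
Proof.
move=> e0; have e20 : 0 < e / 2 by rewrite divr_gt0.
have [f f0 h] := tiling_dist_translate (- disp c) e20.
exists (Num.min f (e / 2)); first by rewrite lt_min f0.
move=> d /hull_rel_dist_lt[]; rewrite !lt_min => /andP[cd _] /andP[cdf cde].
have cdN : frob (- disp c - - disp d) < Num.min f (e / 2).
  by rewrite -opprD frobN lt_min cdf.
move: cdN; rewrite lt_min => /andP[cdf' cde'].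
apply: lt_hull_rel_dist; last by rewrite !swap_disp.
by rewrite !r_swap /hull_dist (dispP c).2 (dispP d).2; exact: h.
Qed.

Lemma hull_equivalence : is_equivalence (@hull_rel R n p x Omega).
Proof.
split=> [a|a b /hull_relP[v av bE]|a b c /hull_relP[v av bE] /hull_relP[w bw cE]];
  apply/hull_relP.
- by exists 0; [exact: hull_origin|rewrite oppr0 translate0].
- exists (- v); last by rewrite opprK bE translateD addrN translate0.
  by have := puncture_of_translate (- v) (hull_origin a); rewrite add0r bE.
- exists (w + v).
    have <- : translate v (hv b) = hv a by rewrite bE translateD addrN translate0.
    exact: puncture_of_translate.
  by rewrite cE bE translateD opprD.
Qed.

Lemma R_punc_pr_bij : set_bij [set: G] (@hull_rel R n p x Omega)
  (@R_punc_pr R n p x Omega).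
Proof.
split=> [c _|c d _ _|ab hab]; first by case: c.
  exact: R_punc_pr_inj.
by exists (exist _ ab hab).
Qed.

(** * Compactness of the hull and sigma-compactness of the relation *)

Lemma hull_complete (u : nat -> X) : metric_cauchy hull_dist u ->
  exists a, metric_limit hull_dist u a.
Proof.
move=> cu; have [_ [_ _ cpl]] := hullT.
have [||T OT lim] := cpl (fun k => hv (u k)) => //.
  by move=> k; exact: hull_Omega.
(* The limit supplied by [Omega] keeps a puncture at the origin, by [puncture_limit]. *)
have XT : discrete_hull p x Omega T.
  apply/discrete_hullP; split=> //.
  apply: (puncture_limit polyp punct (Omega_proto_tiled hullT protop OT)).
  move=> e e0; have [N hN] := lim _ e0; exists (hv (u N)), 0.
  by rewrite subrr frob0 hN //; split=> //; exact: hull_origin.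
by exists (exist _ T XT).
Qed.

Lemma hull_coloring e : 0 < e -> exists (C : choiceType) (c : X -> C),
  finite_set (range c) /\ forall a b, c a = c b -> hull_dist a b < e.
Proof.
move=> e0; have [f [rad [f0 h]]] := close_tiling_dist e0.
have [C [c [fin cP]]] := close_coloring protop flc punct rad f0.
exists C, (fun a => c (hv a)); split.
  apply: sub_finite_set fin => _ [a _ <-]; exists (hv a) => //; by case: a.
move=> a b ab; apply: h; apply: cP ab; [by case: a|by case: b].
Qed.

Lemma hull_compact : compact [set: X].
Proof.
apply: (metric_compact weak_hull_dist) => [e /hull_coloring[C [c [fin cP]]]|u _ cu].
  by exists C, c; split=> // a b _ _; exact: cP.
by have [a lim] := hull_complete cu; exists a.
Qed.

Lemma hull_hausdorff : hausdorff_space X.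
Proof.
apply: (metric_hausdorff weak_hull_dist) => a b ab; apply: hull_val_inj.
by apply: (tiling_dist_eq polyp punct) ab; exact: hull_tiled.
Qed.

(** A pair is encoded by its first tiling, in a compact space, and its displacement, in a bounded
    region; by [puncture_limit] a limit of displacements is a puncture of the limit tiling. *)
Lemma hull_rel_compact (B : R) : compact [set c : G | frob (disp c) <= B].
Proof.
apply: (metric_compact weak_hull_rel_dist) => [e e0|u uB cu].
  have e20 : 0 < e / 2 by rewrite divr_gt0.
  have [C [c [fin cP]]] := hull_coloring e20.
  have [C' [c' cP']] := @frob_coloring R 2 1 B _ e20.
  exists (C * C')%type, (fun d => (c (r d), c' (disp d))); split.
    have : finite_set (range c `*` [set: C']).
      by apply: finite_setX => //; exact: finite_finset.
    by apply: sub_finite_set => _ [d _ <-]; split=> //=; exists (r d).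
  move=> d d' dB d'B [/cP dd' /(cP' _ _ dB d'B) vv'].
  exact: lt_hull_rel_dist.
have [|a alim] := @hull_complete (fun k => r (u k)).
  move=> e /cu[N hN]; exists N => m k Nm Nk.
  by have [] := hull_rel_dist_lt (hN _ _ Nm Nk).
have [|v vlim] := @frob_cauchy_limit R (fun k => disp (u k)).
  move=> e /cu[N hN]; exists N => m k Nm Nk.
  by have [] := hull_rel_dist_lt (hN _ _ Nm Nk).
have av : puncture_of p x (hv a) v.
  apply: (puncture_limit polyp punct (hull_tiled a)) => e e0.
  have [N hN] := alim _ e0; have [N' hN'] := vlim _ e0.
  exists (hv (r (u (maxn N N')))), (disp (u (maxn N N'))); split.
  - by case: (dispP (u (maxn N N'))).
  - by apply: hN; rewrite leq_maxl.
  - by apply: hN'; rewrite leq_maxr.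
have [c ca cv] := disp_ex av; exists c => /=.
  rewrite cv leNgt; apply/negP => Bv.
  have [N hN] := vlim (frob v - B) ltac:(by rewrite subr_gt0).
  have := hN N (leqnn _); have := uB N; rewrite /= frobC.
  by have := frob_trD v (disp (u N)); lra.
move=> e e0; have e20 : 0 < e / 2 by rewrite divr_gt0.
have [N hN] := alim _ e20; have [N' hN'] := vlim _ e20.
exists (maxn N N') => m; rewrite geq_max => /andP[/hN h /hN' h'].
by apply: lt_hull_rel_dist; rewrite ?ca ?cv.
Qed.

Lemma hull_rel_sigma_compact : sigma_compact G.
Proof.
exists (fun k => [set c : G | frob (disp c) <= k%:R]) => [k|].
  exact: hull_rel_compact.
apply/seteqP; split=> // c _; exists (Num.bound (frob (disp c))) => //=.
by rewrite ltW // archi_boundP // frob_ge0.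
Qed.

(** A diagonal pair has displacement 0 by aperiodicity; the displacement of a nearby pair is a
    puncture within [delta] of the puncture 0, hence 0 as well. *)
Lemma diag_open : open (rel_diag (@R_punc_pr R n p x Omega)).
Proof.
have [delta delta0 sep] := punctures_separated polyp punct.
apply/R_punc_openP => c rs; exists delta => // d /hull_rel_dist_lt[_].
have -> : disp c = 0.
  apply/eqP; rewrite -oppr_eq0; apply/eqP/(translate_inj (hull_Omega (r c))).
  by rewrite -(dispP c).2 translate0; congr (hv _).
have [dv dE] := dispP d => /(sep _ _ _ (hull_tiled (r d)) (hull_origin _) dv) d0.
by apply: hull_val_inj; rewrite -/(r d) -/(s d) dE -d0 oppr0 translate0.
Qed.

(** * Local homeomorphisms *)

Section LocalHomeo.
Variable delta : R.
Hypothesis delta0 : 0 < delta.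
Hypothesis sep : forall T v w, proto_tiled p T -> puncture_of p x T v ->
  puncture_of p x T w -> frob (v - w) < delta -> v = w.

(** The quarter keeps the displacements of two members less than [delta / 2] apart, which leaves
    [delta / 2] for a puncture moved to a nearby tiling. *)
Definition sheet (g : G) : set G := [set c | frob (disp c - disp g) < delta / 4].

Lemma sheet_open g : open (sheet g).
Proof.
apply/R_punc_openP => c /= cg; exists (delta / 4 - frob (disp c - disp g)).
  by rewrite subr_gt0.
move=> d /hull_rel_dist_lt[_]; rewrite /sheet /= frobC => dc.
by apply: le_lt_trans (frob_tri (disp c) _ _) _; move: dc; lra.
Qed.

Lemma sheet_refl g : sheet g g.
Proof. by rewrite /sheet /= subrr frob0 divr_gt0. Qed.

Lemma sheet_swap g c : sheet g c -> sheet (swap g) (swap c).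
Proof. by rewrite /sheet /= !swap_disp -opprD frobN. Qed.

Lemma sheet_dist g c d : sheet g c -> sheet g d -> frob (disp c - disp d) < delta / 2.
Proof.
rewrite /sheet /= => cg dg; apply: le_lt_trans (frob_tri (disp g) _ _) _.
by rewrite [frob (disp g - _)]frobC; move: cg dg; lra.
Qed.

Lemma sheet_r_inj g c d : sheet g c -> sheet g d -> r c = r d -> c = d.
Proof.
move=> gc gd cd; apply: disp_inj => //; apply: (sep (hull_tiled (r c))).
- by case: (dispP c).
- by rewrite cd; case: (dispP d).
- by apply: lt_trans (sheet_dist gc gd) _; move: delta0; lra.
Qed.

(** Follow the puncture [disp c] to a puncture [w] of [r d]; both [w] and [disp d] are within
    [delta / 2] of [disp c], so they coincide. *)
Lemma sheet_r_inv_continuous g c e : sheet g c -> 0 < e ->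
  exists2 f : R, 0 < f & forall d, sheet g d ->
    hull_dist (r c) (r d) < f -> hull_rel_dist c d < e.
Proof.
move=> gc e0; pose e1 := Num.min (e / 2) (delta / 2).
have e10 : 0 < e1 by rewrite lt_min !divr_gt0.
have [f f0 h] := puncture_transfer polyp punct (disp c) e10.
exists (Num.min f (e / 2)); first by rewrite lt_min f0 divr_gt0.
move=> d gd; rewrite lt_min => /andP[cdf cde]; apply: lt_hull_rel_dist => //.
have [||w dw] := h (hv (r c)) (hv (r d)) (disp c) _ _ cdf.
- by case: (dispP c).
- by rewrite subrr frob0.
rewrite lt_min => /andP[we wd].
suff <- : w = disp d by rewrite frobC.
apply: (sep (hull_tiled (r d))) => //; first by case: (dispP d).
apply: le_lt_trans (frob_tri (disp c) _ _) _; rewrite [ltRHS]splitr.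
by rewrite ltrD //; exact: sheet_dist gc gd.
Qed.

Lemma homeo_r g : homeo_onto_image r (sheet g).
Proof.
apply: (metric_homeo weak_hull_rel_dist weak_hull_dist).
- by exists g; exact: sheet_refl.
- by move=> a b; exact: sheet_r_inj.
- by move=> a _ e e0; exists e => // b _ /hull_rel_dist_lt[].
- by move=> a ga e; exact: sheet_r_inv_continuous.
Qed.

Lemma homeo_s g : homeo_onto_image s (sheet g).
Proof.
apply: (metric_homeo weak_hull_rel_dist weak_hull_dist).
- by exists g; exact: sheet_refl.
- move=> a b /sheet_swap ga /sheet_swap gb ab.
  by rewrite -[a]swapK -[b]swapK (sheet_r_inj ga gb) // !r_swap.
- move=> a _ e /(swap_continuous a)[f f0 h]; exists f => // b _ /h.
  by move=> /hull_rel_dist_lt[]; rewrite !r_swap.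
- move=> a /sheet_swap ga e /(swap_continuous (swap a))[f f0 h].
  have [f' f'0 h'] := sheet_r_inv_continuous ga f0.
  exists f' => // b /sheet_swap gb ab.
  by rewrite -[a]swapK -[b]swapK; apply/h/h'; rewrite ?r_swap.
Qed.

End LocalHomeo.

(** * Openness of inverses and products *)

Lemma rel_inv_open (U : set G) : open U ->
  open (rel_inv (@R_punc_pr R n p x Omega) U).
Proof.
move=> /R_punc_openP oU; apply/R_punc_openP => c [u Uu cE].
have cu : swap c = u.
  by apply: R_punc_pr_inj; rewrite swap_pr /rel_r /rel_s cE -surjective_pairing.
have [e e0 eU] := oU _ Uu; have [f f0 h] := swap_continuous c e0.
exists f => // d /h; rewrite cu => /eU Ud; exists (swap d) => //.
by rewrite r_swap s_swap -surjective_pairing.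
Qed.

(** Translating [r c] back by either side gives [s c], so aperiodicity identifies the two. *)
Lemma disp_mul (u v c : G) : s u = r v -> R_punc_pr c = (r u, s v) ->
  disp c = disp u + disp v.
Proof.
move=> uv cE; have rE : r c = r u by rewrite /rel_r cE.
have sE : s c = s v by rewrite /rel_s cE.
apply: oppr_inj; apply: (translate_inj (hull_Omega (r c))).
rewrite -(dispP c).2 sE (dispP v).2 -uv (dispP u).2 translateD rE.
by rewrite opprD addrC.
Qed.

(* A factorisation [c = u v] is carried to a nearby [d] by moving the puncture
   [disp u] of [r c] to a puncture [w] of [r d]. *)
Lemma rel_mul_open (U V : set G) : open U -> open V ->
  open (rel_mul (@R_punc_pr R n p x Omega) U V).
Proof.
move=> /R_punc_openP oU /R_punc_openP oV; apply/R_punc_openP.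
move=> c [u [v [Uu Vv uv cE]]].
have rE : r c = r u by rewrite /rel_r cE.
have dE := disp_mul uv cE.
have [e1 e10 eU] := oU _ Uu; have [e2 e20 eV] := oV _ Vv.
have e220 : 0 < e2 / 2 by rewrite divr_gt0.
have [f2 f20 h2] := tiling_dist_translate (- disp u) e220.
(* [e1 / 2] keeps the first factor in [U], [f2] controls the first tiling of the second factor, and
   two errors below [e2 / 4] bound that of its displacement. *)
pose eta := Num.min (e1 / 2) (Num.min f2 (e2 / 4)).
have eta0 : 0 < eta by rewrite !lt_min f20 !divr_gt0.
have [f f0 h] := puncture_transfer polyp punct (disp u) eta0.
exists (Num.min f eta); first by rewrite lt_min f0.
move=> d /hull_rel_dist_lt[]; rewrite !lt_min.
move=> /and4P[cdf cd1 cd2 cd4] /and4P[_ _ _ cd4'].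
have [||w dw] := h (hv (r c)) (hv (r d)) (disp u) _ _ cdf.
- by rewrite rE; case: (dispP u).
- by rewrite subrr frob0.
rewrite !lt_min frobC => /and3P[w1 w2 w4].
have [u1 u1r u1w] := disp_ex dw.
have su1 : hv (s u1) = translate (- w) (hv (r d)).
  by rewrite (dispP u1).2 u1r u1w.
(* The displacement of the second factor is forced by the product being [d]. *)
have [||v1 v1E v1w] := @disp_mk (s u1) (s d) (disp d - w).
- by rewrite su1; apply: puncture_of_translate; case: (dispP d).
- by rewrite su1 translateD (dispP d).2 opprB addrAC subrr sub0r.
have v1r : r v1 = s u1 by rewrite /rel_r v1E.
exists u1, v1; split.
- by apply: eU; apply: lt_hull_rel_dist; rewrite ?u1r ?u1w // -rE.
- apply: eV; apply: lt_hull_rel_dist.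
    rewrite v1r -uv /hull_dist su1 (dispP u).2; apply: h2.
      by rewrite -rE.
    by rewrite -opprD frobN.
  have -> : disp v - disp v1 = (disp c - disp d) + (w - disp u).
    by apply/matrixP => i j; rewrite v1w dE !mxE; ring.
  apply: le_lt_trans (frobD _ _) _; rewrite [frob (w - _)]frobC.
  by move: cd4' w4; lra.
- by rewrite v1r.
- by rewrite [LHS]surjective_pairing /rel_r /rel_s v1E -/(r u1) u1r.
Qed.

End Etale.

Theorem proposition2p7 (R : realType) (T : tiles R) (Omega : set (tiles R))
    (n : nat) (p : 'I_n -> set 'cV[R]_2) (x : 'I_n -> 'cV[R]_2)
    (tilingT : is_tiling T)
    (hullT : is_continuous_hull T Omega)
    (protop : prototiles_of p Omega)
    (fullG : full_isometry_group p Omega)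
    (flc : finite_local_complexity Omega)
    (aper : strongly_aperiodic Omega)
    (punct : puncturing p x) :
  R_punc p x Omega `<=` discrete_hull p x Omega `*` discrete_hull p x Omega /\
  etale_equivalence_relation (@hull_rel R n p x Omega) (@R_punc_pr R n p x Omega).
Proof.
split.
  move=> [T1 T2] [/= XT1 [v [T1v /= ->]]]; split=> //=.
  by apply: (discrete_hull_translate hullT protop punct) T1v; case: XT1.
have [delta delta0 sep] := punctures_separated (polygon_p protop) punct.
split.
- by split; [exact: hull_equivalence|exact: R_punc_pr_bij].
- by split; [exact: (hull_compact hullT)|exact: (hull_hausdorff hullT)].
- split; first exact: (hull_rel_sigma_compact hullT).
  exact: (diag_open hullT).
- move=> g; exists (sheet delta g); split.
  + exact: sheet_open.
  + exact: sheet_refl.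
  + exact: (homeo_r hullT protop punct delta0 sep).
  + exact: (homeo_s hullT protop aper punct delta0 sep).
- split; first exact: (rel_mul_open hullT).
  exact: (rel_inv_open aper).
Qed.
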